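(* Let $\kappa\in(0,1]$. The metric space $(\mathfrak K(\tau),d^{\tau,\mathrm{BL}^\kappa}_{\mathfrak K})$ is complete and separable.
   Context: A measured compact metric space is $(X,d^X,\mu_X)$ with $(X,d^X)$ a (non-empty) compact metric space and $\mu_X$ a Radon (hence finite) Borel measure on $X$. Two such are equivalent if there is an isometry from one onto the other pushing the first measure to the second. $\mathfrak K(\tau)$ is a set of measured compact metric spaces containing exactly one representative of each equivalence class. For a compact metric space $(Z,d^Z)$: $d^Z_{\mathrm H}$ is the Hausdorff distance between compact subsets; $\|f\|_{\mathrm{BL}^\kappa(Z)}=\sup_Z|f|+\sup_{x\ne y}|f(x)-f(y)|/d^Z(x,y)^\kappa$; for finite Radon measures, $d^Z_{\mathrm{BL}^\kappa}(\mu,\nu)=\sup\{|\int f\,d(\mu-\nu)|:\|f\|_{\mathrm{BL}^\kappa(Z)}\le1\}$. $d^{\tau,\mathrm{BL}^\kappa}_{\mathfrak K}(\mathcal X,\mathcal Y)=\inf_{f,g,Z}\{d^Z_{\mathrm H}(f(X),g(Y))\vee d^Z_{\mathrm{BL}^\kappa}(\mu_X\circ f^{-1},\mu_Y\circ g^{-1})\}$, the infimum over all compact metric spaces $(Z,d^Z)$ and isometric embeddings $f:X\to Z$, $g:Y\to Z$. *)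

(* Defs.v *)
From HB Require Import structures.
From mathcomp Require Import all_boot all_order all_algebra.
From mathcomp Require Import all_classical all_reals all_analysis.
Set Implicit Arguments.
Unset Strict Implicit.
Unset Printing Implicit Defensive.
Import Order.TTheory GRing.Theory Num.Theory.
Import numFieldNormedType.Exports.
Local Open Scope classical_set_scope.
Local Open Scope ring_scope.

(* Non-empty metric spaces: MathComp-Analysis measurable types carry a point.
   Only its existence matters: no notion below refers to the chosen point. *)
#[short(type="pmetricType")]
HB.structure Definition PointedMetric (R : numDomainType) :=
  {T of Pointed T & Metric R T}.

(* T equipped with its Borel sigma-algebra. *)
Notation borel T := (g_sigma_algebraType (@open T)).

Definition isometric (R : numDomainType) (X Y : metricType R) (f : X -> Y) :=
  forall x y : X, mdist (f x) (f y) = mdist x y.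

Definition radon (R : realType) (T : ptopologicalType)
    (mu : {measure set (borel T) -> \bar R}) : Prop :=
  (forall C : set T, compact C -> (mu C < +oo)%E) /\
  (forall A : set (borel T), measurable A ->
     mu A = ereal_sup [set mu C | C in [set C : set T | compact C /\ C `<=` A]]).

Record mcms (R : realType) : Type := MCMS {
  mcms_space :> pmetricType R;
  mcms_compact : compact [set: mcms_space];
  mcms_mu : {measure set (borel mcms_space) -> \bar R};
  mcms_radon : radon mcms_mu
}.

(* The image measure mu_X \o f^-1 on the Borel sets of Z. *)
Definition mcms_push (R : realType) (X : mcms R) (Z : pmetricType R)
    (f : X -> Z) : set (borel Z) -> \bar R :=
  pushforward (mcms_mu X) (f : borel X -> borel Z).

Definition mcms_equiv (R : realType) (X Y : mcms R) : Prop :=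
  exists phi : X -> Y,
    [/\ isometric phi, range phi = setT
      & forall B : set (borel Y), measurable B ->
          mcms_push phi B = mcms_mu Y B].

Definition representatives (R : realType) (K : set (mcms R)) : Prop :=
  forall X : mcms R, exists! Y : mcms R, K Y /\ mcms_equiv X Y.

Definition hausdorff_dist (R : realType) (Z : metricType R) (A B : set Z)
    : \bar R :=
  maxe (ereal_sup [set ereal_inf [set (mdist a b)%:E | b in B] | a in A])
       (ereal_sup [set ereal_inf [set (mdist a b)%:E | a in A] | b in B]).

(* maxe 0 because the supremum over x <> y is 0, not -oo, when Z is a point. *)
Definition bl_norm (R : realType) (kappa : R) (Z : metricType R) (f : Z -> R)
    : \bar R :=
  (ereal_sup [set `|f x|%:E | x in [set: Z]] +
   maxe 0 (ereal_sup
     [set (`|f p.1 - f p.2| / mdist p.1 p.2 `^ kappa)%:E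
        | p in [set p : Z * Z | p.1 <> p.2]]))%E.

(* Stated for set functions so that it applies to image measures directly. *)
Definition bl_dist (R : realType) (kappa : R) (Z : pmetricType R)
    (mu nu : set (borel Z) -> \bar R) : \bar R :=
  ereal_sup [set `| \int[mu]_(z in setT) (f z)%:E
                    - \int[nu]_(z in setT) (f z)%:E |%E
              | f in [set f : Z -> R | (bl_norm kappa f <= 1)%E]].

Definition mcms_dist (R : realType) (kappa : R) (X Y : mcms R) : \bar R :=
  ereal_inf [set r : \bar R |
    exists (Z : pmetricType R) (f : X -> Z) (g : Y -> Z),
      [/\ compact [set: Z], isometric f, isometric g
        & r = maxe (hausdorff_dist (range f) (range g))
                   (bl_dist kappa (mcms_push f) (mcms_push g))]].

(* Metric notions for an \bar R-valued d on a subset K of a plain type T: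
   finiteness and the metric axioms on K are part of what is claimed, so they
   are not bundled into a metricType structure. *)
Definition metric_on (R : realType) (T : Type) (K : set T) (d : T -> T -> \bar R)
    : Prop :=
  [/\ forall x y, K x -> K y -> (0 <= d x y < +oo)%E,
      forall x y, K x -> K y -> (d x y = 0%E <-> x = y),
      forall x y, K x -> K y -> d x y = d y x
    & forall x y z, K x -> K y -> K z -> (d x z <= d x y + d y z)%E].

Definition complete_on (R : realType) (T : Type) (K : set T)
    (d : T -> T -> \bar R) : Prop :=
  forall u : nat -> T, (forall n, K (u n)) ->
    (forall e : R, 0 < e -> exists N : nat, forall m n : nat,
       (N <= m)%N -> (N <= n)%N -> (d (u m) (u n) < e%:E)%E) ->
    exists2 l : T, K l & (fun n => d (u n) l) @ \oo --> 0%E.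

Definition separable_on (R : realType) (T : Type) (K : set T)
    (d : T -> T -> \bar R) : Prop :=
  exists D : set T, [/\ D `<=` K, countable D
    & forall x, K x -> forall e : R, 0 < e ->
        exists2 y, D y & (d x y < e%:E)%E].

(* Main.v *)
Require Import Defs.
From HB Require Import structures.
From mathcomp Require Import all_boot all_order all_algebra.
From mathcomp Require Import all_classical all_reals all_analysis.
From mathcomp Require Import finmap lra measurable_realfun.
Set Implicit Arguments.
Unset Strict Implicit.
Unset Printing Implicit Defensive.
Import Order.TTheory GRing.Theory Num.Theory.
Import numFieldNormedType.Exports.
Local Open Scope classical_set_scope.
Local Open Scope ring_scope.


(** Why the theorem holds.

    Two measured spaces are close exactly when some relation between their points
    has small distortion and, along it, Hölder functions that nearly agree have
    nearly equal integrals (mcms_dist_lt_coupling and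
    mcms_dist_le_correspondence).  McShane's formula, which extends a Hölder
    function without increasing its bound or its Hölder constant, makes this
    possible: a test function on one space can be carried to the ambient space,
    or to the other space.  The triangle inequality glues two ambient spaces along
    the middle one; the rest of the proof argues mostly with relations.

    Separation: if the distance is zero, points related at scale 1/n have a limit
    along a free ultrafilter.  The limit map is a surjective isometry, and it
    carries one measure to the other because the integrals of Hölder functions
    agree and these integrals determine a finite Borel measure
    (finite_measure_eq).

    Completeness: along a subsequence, consecutive spaces are related at scales
    that decay geometrically.  The sequences of successively related points,
    called threads, form after identification a compact metric space, and
    the integrals of transferred Hölder functions converge to a positive linear
    functional on it.  A Riesz representation theorem for functionals that are
    defined on Hölder functions only (riesz_holderian) turns it into a Radon
    measure.

    Separability: a finite net, its distance matrix and the masses of a Borel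
    partition subordinate to the net describe a space up to a small error, and
    these data can be rounded to rational numbers.  Two spaces described by the
    same rational data are close (represents_dist), so one space in K for each
    precision and each realized description gives a dense countable set. *)

(** * Metric identification of a pseudometric *)
Record pseudometric (R : realType) (T : Type) := Pseudometric {
  pdist :> T -> T -> R;
  pdist_point : T;
  pdistxx : forall x, pdist x x = 0;
  pdist_sym : forall x y, pdist x y = pdist y x;
  pdist_triangle : forall y x z, pdist x z <= pdist x y + pdist y z }.

(** The carrier stores a predicate of type [T -> Prop] instead of a set of [T]:
    the type [set T] lives in a fixed universe in which the quotient could not
    serve as the carrier of a metric space. *)
Record identification (R : realType) (T : Type) (d : pseudometric R T) :=
  Identification {
    zero_class : T -> Prop;
    zero_classP : exists t, zero_class = (fun u => d t u = 0) }.

Section identification.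
Context (R : realType) (T : Type) (d : pseudometric R T).
Local Notation Q := (identification d).

Definition ident_proj (t : T) : Q :=
  Identification (ex_intro (fun s => (fun u => d t u = 0) = (fun u => d s u = 0))
                    t erefl).

Definition ident_repr (q : Q) : T := projT1 (cid (zero_classP q)).

Lemma ident_projK q : ident_proj (ident_repr q) = q.
Proof.
rewrite /ident_proj /ident_repr; case: q => A [t tA] /=; move: (ex_intro _ t tA).
move=> e; case: cid => u uA /=; move: (ex_intro _ u _) => e'; move: e e'.
by rewrite -uA => e e'; congr Identification; exact: Prop_irrelevance.
Qed.

Lemma pdist_ge0 (x y : T) : 0 <= d x y.
Proof.
have := pdist_triangle d y x x; rewrite (pdist_sym d y x) pdistxx => H; lra.
Qed.

Lemma ident_repr_proj t : d t (ident_repr (ident_proj t)) = 0.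
Proof.
have H := f_equal (@zero_class _ _ _) (ident_projK (ident_proj t)).
move: H; set u := ident_repr _ => /= H.
by have /= := f_equal (fun A => A u) H; rewrite pdistxx => <-.
Qed.

Definition ident_dist (p q : Q) : R := d (ident_repr p) (ident_repr q).

Lemma ident_distE x y : ident_dist (ident_proj x) (ident_proj y) = d x y.
Proof.
have hx := ident_repr_proj x; have hy := ident_repr_proj y.
rewrite /ident_dist; set u := ident_repr _ in hx *; set v := ident_repr _ in hy *.
have := pdist_triangle d u x y; have := pdist_triangle d v u y.
have := pdist_triangle d x u v; have := pdist_triangle d y x v.
rewrite (pdist_sym d v y) (pdist_sym d u x) => h1 h2 h3 h4.
apply/eqP; rewrite eq_le; apply/andP; split; lra.
Qed.

HB.instance Definition _ := gen_eqMixin Q.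
HB.instance Definition _ := gen_choiceMixin Q.
HB.instance Definition _ := isPointed.Build Q (ident_proj (pdist_point d)).

Let ident_distxx p : ident_dist p p = 0.
Proof. exact: pdistxx. Qed.

Let ident_dist_eq0 p q : ident_dist p q = 0 -> p = q.
Proof.
rewrite /ident_dist => pq0; rewrite -(ident_projK p) -(ident_projK q).
set u := ident_repr p in pq0 *; set v := ident_repr q in pq0 *.
suff e : (fun w => d u w = 0) = (fun w => d v w = 0).
  rewrite /ident_proj; move: (ex_intro _ u _) (ex_intro _ v _); rewrite e => e1 e2.
  by congr Identification; exact: Prop_irrelevance.
apply/funext => w; apply/propext.
have h' := pdist_ge0 u w; have h'' := pdist_ge0 v w; split=> h.
  have := pdist_triangle d u v w; rewrite (pdist_sym d v u) => *.
  by apply/eqP; rewrite eq_le; apply/andP; split; lra.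
have := pdist_triangle d v u w => *.
by apply/eqP; rewrite eq_le; apply/andP; split; lra.
Qed.

Let ident_dist_sym p q : ident_dist p q = ident_dist q p.
Proof. exact: pdist_sym. Qed.

Let ident_dist_triangle q p r : ident_dist p r <= ident_dist p q + ident_dist q r.
Proof. exact: pdist_triangle. Qed.

HB.instance Definition _ := isMetric.Build R Q
  ident_distxx ident_dist_eq0 ident_dist_sym ident_dist_triangle.

End identification.

Lemma metric_identification (R : realType) (T : Type) (d : pseudometric R T) :
  exists (Q : pmetricType R) (p : T -> Q),
    (forall q, exists t, p t = q) /\ forall x y, mdist (p x) (p y) = d x y.
Proof.
exists (identification d), (ident_proj d); split.
  by move=> q; exists (ident_repr q); exact: ident_projK.
by move=> x y; exact: ident_distE.
Qed.

(** * Ultrafilter limits and finite nets in compact metric spaces *)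
Lemma free_ultrafilter :
  exists2 U : set_system nat, UltraFilter U & \oo `<=` U.
Proof. by have [U [UU sU]] := ultraFilterLemma eventually_filter; exists U. Qed.

Lemma ultra_cvg (R : realType) (X : metricType R) (I : Type) (U : set_system I)
    (x : I -> X) : UltraFilter U -> compact [set: X] ->
  exists l, forall e, 0 < e -> U [set n | mdist l (x n) < e].
Proof.
move=> UU cX; have [|l [_ hl]] := cX (x @ U) _; first exact: filterT.
exists l => e e0.
have nl : nbhs l (ball l e) by exact: nbhsx_ballx.
have [//|Un] := in_ultra_setVsetC [set n | mdist l (x n) < e] UU.
have FA : (x @ U) (~` ball l e).
  rewrite /fmap /=; apply: filterS Un => n nlt /=. by rewrite ballEmdist.
by have [y []] := hl _ _ FA nl.
Qed.

Lemma finite_net (R : realType) (X : pmetricType R) (e : R) :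
  compact [set: X] -> 0 < e ->
  exists (n : nat) (a : 'I_n.+1 -> X), forall x, exists i, mdist (a i) x < e.
Proof.
rewrite compact_cover => cX e0.
have [|x _|D _ Dc] := cX X setT (fun x => (ball x e)°).
- by move=> x _; exact: open_interior.
- exists x => //.
  by apply: nbhs_singleton; apply: nbhs_interior; exact: nbhsx_ballx.
pose s := point :: enum_fset D.
exists (size (enum_fset D)), (fun i => nth point s i) => x.
have [y /= yD xy] := Dc x I.
have ys : y \in s by rewrite inE; apply/orP; right.
have ls : (index y s < (size (enum_fset D)).+1)%N by rewrite -[X in (_ < X)%N]/(size s) index_mem.
exists (Ordinal ls); rewrite /= nth_index//.
by have /= := interior_subset xy; rewrite ballEmdist.
Qed.

(** * Hölder functions and McShane extension *)
Section infimum.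
Context (R : realType) (I : Type).
Implicit Type F : I -> R.

Lemma inf_range_le F m i : (forall j, m <= F j) -> inf (range F) <= F i.
Proof.
by move=> mF; apply: ge_inf; [exists m => _ [j _ <-]; exact: mF|exists i].
Qed.

Lemma le_inf_range F m (i0 : I) : (forall j, m <= F j) -> m <= inf (range F).
Proof. by move=> mF; apply: lb_le_inf => [|_ [j _ <-]//]; exists (F i0), i0. Qed.

End infimum.

Section holder.
Context (R : realType) (k : R).
Hypothesis k01 : 0 < k <= 1.

Let k_gt0 : 0 < k. Proof. by case/andP: k01. Qed.

Lemma powR_le (a b : R) : 0 <= a -> a <= b -> a `^ k <= b `^ k.
Proof.
move=> a0 ab; apply: ge0_ler_powR; rewrite ?nnegrE ?(ltW k_gt0)//.
exact: le_trans ab.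
Qed.

(** Concavity: each of [a / (a + b)] and [b / (a + b)] lies in [0, 1], hence is at most
    its own power of exponent [k <= 1].  This subadditivity makes [mdist `^ k] satisfy
    the triangle inequality, on which McShane's formula rests. *)
Lemma powRD_le (a b : R) : 0 <= a -> 0 <= b -> (a + b) `^ k <= a `^ k + b `^ k.
Proof.
move=> a0 b0; have [ab0|ab0] := eqVneq (a + b) 0.
  by rewrite ab0 powR0 ?gt_eqF// addr_ge0// powR_ge0.
have ab : 0 < a + b by rewrite lt_neqAle eq_sym ab0 addr_ge0.
have t c : 0 <= c -> c <= a + b -> (a + b) `^ k * (c / (a + b)) <= c `^ k.
  move=> c0 cab.
  have [->|cn0] := eqVneq c 0; first by rewrite mul0r mulr0 powR_ge0.
  have cp : 0 < c by rewrite lt_neqAle eq_sym cn0.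
  have e : c = (a + b) * (c / (a + b)) by rewrite mulrCA divff// mulr1.
  rewrite [X in _ <= X `^ k]e powRM ?(ltW ab) ?divr_ge0 ?(ltW ab)//.
  apply: ler_wpM2l; first exact: powR_ge0.
  apply: ger1_powR; last by case/andP: k01.
  by rewrite divr_gt0//= ler_pdivrMr// mul1r.
have := t a a0; have := t b b0.
rewrite lerDl lerDr => /(_ a0) hb /(_ b0) ha.
have e : (a + b) `^ k = (a + b) `^ k * (a / (a + b)) + (a + b) `^ k * (b / (a + b)).
  by rewrite -mulrDr -mulrDl divff// mulr1.
by rewrite [X in X <= _]e; exact: lerD.
Qed.

Lemma powR_small (e : R) : 0 < e -> exists2 d, 0 < d & d `^ k <= e.
Proof.
move=> e0; exists (e `^ k^-1); first exact: powR_gt0.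
by rewrite -powRrM mulVf ?gt_eqF// powRr1// ltW.
Qed.

Definition holder (Z : metricType R) (s L : R) (f : Z -> R) :=
  (forall x, `|f x| <= s) /\
  (forall x y, `|f x - f y| <= L * mdist x y `^ k).

(** The unit ball is described by explicit bounds [s] and [L] because extensions and
    transfers preserve the two bounds separately, hence also their sum. *)
Lemma bl_norm_le1P (Z : pmetricType R) (f : Z -> R) :
  (bl_norm k f <= 1)%E <->
  exists s L, [/\ 0 <= s, 0 <= L, s + L <= 1 & holder s L f].
Proof.
rewrite /bl_norm.
set A := [set `|f x|%:E | x in _]; set B := [set _ | p in _].
have f_le x : (`|f x|%:E <= ereal_sup A)%E by apply: ereal_sup_ubound; exists x.
have S0 : (0 <= ereal_sup A)%E.
  by apply: le_trans (f_le point); rewrite lee_fin.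
set m := maxe 0%E (ereal_sup B).
have m0 : (0 <= m)%E by rewrite le_max lexx.
split.
- move=> h.
  have Sfin : ereal_sup A \is a fin_num.
    rewrite ge0_fin_numE//; apply: le_lt_trans (ltry 1).
    by apply: le_trans h; rewrite leeDl.
  have mfin : m \is a fin_num.
    rewrite ge0_fin_numE//; apply: le_lt_trans (ltry 1).
    by apply: le_trans h; rewrite leeDr.
  exists (fine (ereal_sup A)), (fine m); split.
  + exact: fine_ge0.
  + exact: fine_ge0.
  + by rewrite -lee_fin EFinD !fineK.
  split=> [x|x y]; first by rewrite -lee_fin fineK.
  have [->|xy] := eqVneq x y.
    by rewrite subrr normr0 mulr_ge0 ?fine_ge0 ?powR_ge0.
  rewrite -ler_pdivrMr; last by rewrite powR_gt0// mdist_gt0.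
  rewrite -lee_fin fineK// le_max; apply/orP; right.
  by apply: ereal_sup_ubound; exists (x, y) => //=; apply/eqP.
- move=> [s [L [s0 L0 sL [fs fL]]]].
  apply: (@le_trans _ _ (s%:E + L%:E)%E); last by rewrite -EFinD lee_fin.
  apply: leeD.
    by apply: ge_ereal_sup => _ [x _ <-]; rewrite lee_fin.
  rewrite ge_max lee_fin L0 /=; apply: ge_ereal_sup => _ [[x y] /= xy <-].
  rewrite lee_fin ler_pdivrMr; first exact: fL.
  by rewrite powR_gt0// mdist_gt0; apply/eqP.
Qed.

Let clip (s a : R) := Num.max (- s) (Num.min s a).

Let clip_le s a b e : 0 <= e -> a <= b + e -> clip s a <= clip s b + e.
Proof.
rewrite /clip => e0 abe; rewrite ge_max; apply/andP; split.
  have : - s <= Num.max (- s) (Num.min s b) by rewrite le_max lexx.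
  lra.
have : Num.min s b <= Num.max (- s) (Num.min s b) by rewrite le_max lexx orbT.
have : Num.min s a <= s by rewrite ge_min lexx.
have : Num.min s a <= a by rewrite ge_min lexx orbT.
by have [_|_] := leP s b; lra.
Qed.

Let clip_norm s a : 0 <= s -> `|clip s a| <= s.
Proof.
move=> s0; rewrite /clip ler_norml le_max lexx ge_max ge_min lexx /= andbT.
by lra.
Qed.

Let clipK s a : `|a| <= s -> clip s a = a.
Proof.
by rewrite /clip ler_norml => /andP[? ?]; rewrite min_r// max_r.
Qed.

(** The extension is [H z = inf_t (h t + L * D z t ^ k)], truncated to [-s, s].
    The points [z] and [t] are linked only by the numbers [D z t], so the same formula
    serves for an extension from a subspace and for a transfer along a relation. *)
Lemma mcshane (T Z : Type) (t0 : T) (h : T -> R) (D : Z -> T -> R) (s L : R) :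
  0 <= L -> (forall z t, 0 <= D z t) -> (forall t, `|h t| <= s) ->
  (forall z t t', h t - h t' <= L * (D z t + D z t') `^ k) ->
  exists H : Z -> R,
  [/\ forall z, `|H z| <= s,
      forall z z' e, 0 <= e -> (forall t, D z t <= D z' t + e) ->
        (forall t, D z' t <= D z t + e) -> `|H z - H z'| <= L * e `^ k
    & forall z t, `|H z - h t| <= L * D z t `^ k].
Proof.
move=> L0 D0 hs hL.
have s0 : 0 <= s by apply: le_trans (hs t0).
pose G z := inf (range (fun t => h t + L * D z t `^ k)).
have lb z t : forall t', h t - L * D z t `^ k <= h t' + L * D z t' `^ k.
  move=> t'; have := hL z t t'.
  have := ler_wpM2l L0 (powRD_le (D0 z t) (D0 z t')); lra.
have Gle z t : G z <= h t + L * D z t `^ k.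
  exact: (inf_range_le _ (lb z t)).
have Gge z t : h t - L * D z t `^ k <= G z.
  exact: (le_inf_range t0 (lb z t)).
have GL z z' e : 0 <= e -> (forall t, D z t <= D z' t + e) -> G z <= G z' + L * e `^ k.
  move=> e0 zz'; rewrite -lerBlDr; apply: (le_inf_range t0) => t.
  have := Gle z t; have := ler_wpM2l L0 (powRD_le (D0 z' t) e0).
  by have := ler_wpM2l L0 (powR_le (D0 z t) (zz' t)); lra.
have Le0 e : 0 <= L * e `^ k by rewrite mulr_ge0// powR_ge0.
exists (fun z => clip s (G z)); split.
- by move=> z; exact: clip_norm.
- move=> z z' e e0 h1 h2; rewrite ler_norml.
  have := clip_le s (Le0 e) (GL _ _ _ e0 h1).
  by have := clip_le s (Le0 e) (GL _ _ _ e0 h2); lra.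
- move=> z t; rewrite ler_norml.
  have := clip_le s (Le0 _) (Gle z t).
  have : h t <= G z + L * D z t `^ k by have := Gge z t; lra.
  move/(clip_le s (Le0 _)).
  by rewrite (clipK (hs t)); lra.
Qed.

End holder.

(** * Integrals of bounded Borel functions *)
Section bounded_measurable.
Context (d : measure_display) (T : measurableType d) (R : realType).
Variable mu : {measure set T -> \bar R}.
Hypothesis mu_fin : (mu setT < +oo)%E.

Definition bounded_measurable (f : T -> R) :=
  measurable_fun setT f /\ exists C, forall x, `|f x| <= C.

Lemma bmeas_integrable f : bounded_measurable f ->
  mu.-integrable setT (EFin \o f).
Proof.
move=> [mf [C fC]]; apply: measurable_bounded_integrable => //.
exists C; split; first exact: num_real.
by move=> M CM x _ /=; apply: le_trans (fC x) (ltW CM).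
Qed.

Lemma bmeas_cst c : bounded_measurable (fun=> c).
Proof. by split => //; exists `|c|. Qed.

Lemma bmeasD f g : bounded_measurable f -> bounded_measurable g ->
  bounded_measurable (fun x => f x + g x).
Proof.
move=> [mf [C fC]] [mg [D gD]]; split; first exact: measurable_funD.
by exists (C + D) => x; rewrite (le_trans (ler_normD _ _))// lerD.
Qed.

Lemma bmeasZ c f : bounded_measurable f -> bounded_measurable (fun x => c * f x).
Proof.
move=> [mf [C fC]]; split; first by apply: measurable_funM.
by exists (`|c| * C) => x; rewrite normrM ler_wpM2l.
Qed.

Lemma bmeasB f g : bounded_measurable f -> bounded_measurable g ->
  bounded_measurable (fun x => f x - g x).
Proof.
move=> bf bg; rewrite (_ : (fun x => _) = (fun x => f x + -1 * g x)).
  exact: bmeasD bf (bmeasZ (-1) bg).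
by apply/funext => x; rewrite mulN1r.
Qed.

Lemma bmeas_sum (I : Type) (r : seq I) (F : I -> T -> R) :
  (forall i, bounded_measurable (F i)) ->
  bounded_measurable (fun x => \sum_(i <- r) F i x).
Proof.
move=> bF; elim: r => [|i r IH].
  by under eq_fun do rewrite big_nil; exact: bmeas_cst.
by under eq_fun do rewrite big_cons; exact: bmeasD.
Qed.

Lemma bmeas_EFin f : bounded_measurable f ->
  (\int[mu]_x (f x)%:E)%E = (\int[mu]_x f x)%:E.
Proof.
by move=> bf; rewrite /Rintegral fineK//; apply: integrable_fin_num => //;
  exact: bmeas_integrable.
Qed.

Lemma bmeas_intD f g : bounded_measurable f -> bounded_measurable g ->
  \int[mu]_x (f x + g x) = \int[mu]_x f x + \int[mu]_x g x.
Proof. by move=> bf bg; rewrite RintegralD//; exact: bmeas_integrable. Qed.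

Lemma bmeas_intB f g : bounded_measurable f -> bounded_measurable g ->
  \int[mu]_x (f x - g x) = \int[mu]_x f x - \int[mu]_x g x.
Proof. by move=> bf bg; rewrite RintegralB//; exact: bmeas_integrable. Qed.

Lemma bmeas_intZ c f : bounded_measurable f ->
  \int[mu]_x (c * f x) = c * \int[mu]_x f x.
Proof. by move=> bf; rewrite RintegralZl//; exact: bmeas_integrable. Qed.

Lemma bmeas_int_sum (I : Type) (r : seq I) (F : I -> T -> R) :
  (forall i, bounded_measurable (F i)) ->
  \int[mu]_x (\sum_(i <- r) F i x) = \sum_(i <- r) \int[mu]_x F i x.
Proof.
move=> bF; elim: r => [|i r IH].
  rewrite big_nil; under eq_Rintegral do rewrite big_nil.
  by rewrite Rintegral_cst// mul0r.
rewrite big_cons -IH -bmeas_intD//; last exact: bmeas_sum.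
by apply: eq_Rintegral => x _; rewrite big_cons.
Qed.

Lemma bmeas_int_cst c : \int[mu]_x (c : R) = c * fine (mu setT).
Proof. by rewrite Rintegral_cst. Qed.

Lemma bmeas_int_le f g : bounded_measurable f -> bounded_measurable g ->
  (forall x, f x <= g x) -> \int[mu]_x f x <= \int[mu]_x g x.
Proof. by move=> bf bg fg; apply: le_Rintegral => //; exact: bmeas_integrable. Qed.

(** Uniformly close functions have close integrals; all error estimates below go
    through this bound. *)
Lemma bmeas_int_dist f g c : bounded_measurable f -> bounded_measurable g ->
  (forall x, `|f x - g x| <= c) ->
  `|\int[mu]_x f x - \int[mu]_x g x| <= c * fine (mu setT).
Proof.
move=> bf bg fg; have bB := bmeasB bf bg.
have bc := bmeas_cst c; have bNc := bmeas_cst (- c).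
have eN : - (c * fine (mu setT)) = \int[mu]_x (- c).
  by rewrite bmeas_int_cst mulNr.
rewrite -bmeas_intB// ler_norml eN -bmeas_int_cst.
by apply/andP; split; apply: bmeas_int_le => // x; have := fg x;
  rewrite ler_norml => /andP[].
Qed.

Lemma bmeas_int_indic (A : set T) : measurable A ->
  \int[mu]_x (\1_A x : R) = fine (mu A).
Proof. by move=> mA; rewrite /Rintegral integral_indic// setIT. Qed.

Lemma bmeas_indic (A : set T) : measurable A -> bounded_measurable \1_A.
Proof.
move=> mA; split; first exact: measurable_indic.
by exists 1 => x; rewrite indicE; case: (_ \in _); rewrite /= ?normr0 ?normr1 ?ler01.
Qed.

End bounded_measurable.

Section borel.
Context (R : realType) (k : R).
Hypothesis k01 : 0 < k <= 1.
Local Notation holder := (holder k).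

Lemma open_borel (X : ptopologicalType) (A : set X) :
  open A -> measurable (A : set (borel X)).
Proof. by move=> oA; exact: sub_sigma_algebra. Qed.

Lemma continuous_borel (X Z : ptopologicalType) (f : X -> Z) :
  continuous f -> measurable_fun setT (f : borel X -> borel Z).
Proof.
move=> /continuousP cf; apply: (@measurability _ _ (borel X) (borel Z) setT f open erefl).
move=> _ [B oB <-].
by rewrite setTI; apply: open_borel; exact: cf.
Qed.

Lemma continuous_borelR (X : ptopologicalType) (f : X -> R) :
  continuous f -> measurable_fun setT (f : borel X -> R).
Proof.
move=> /continuousP cf; apply: (measurability _ (RGenOpens.measurableE R)).
move=> _ [_ [a [b ->] <-]]; rewrite setTI; apply: open_borel.
by apply: cf; exact: interval_open.
Qed.

Lemma isometric_continuous (X Z : pmetricType R) (f : X -> Z) :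
  isometric f -> continuous f.
Proof.
move=> isof x; apply/metricType_numDomainType.cvgrPdist_lt => e e0.
near=> y; rewrite isof; near: y.
by apply: metricType_numDomainType.cvgr_dist_lt => //; exact: cvg_id.
Unshelve. all: by end_near. Qed.

Lemma holder_continuous (X : pmetricType R) s L (f : X -> R) :
  holder s L f -> continuous f.
Proof.
move=> [_ fL] x; apply/cvgrPdist_lt => e e0.
have e1 : 0 < e / (`|L| + 1) / 2 by rewrite !divr_gt0// ltr_wpDl.
have [d d0 dk] := powR_small k01 e1.
have h : \forall y \near x, mdist x y < d.
  by apply: metricType_numDomainType.cvgr_dist_lt => //; exact: cvg_id.
apply: filterS h => y xy; apply: le_lt_trans (fL x y) _.
have l1 : mdist x y `^ k <= e / (`|L| + 1) / 2.
  by apply: le_trans dk; apply: powR_le => //; [exact: mdist_ge0|exact: ltW].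
apply: (@le_lt_trans _ _ ((`|L| + 1) * (e / (`|L| + 1) / 2))).
  apply: (@le_trans _ _ ((`|L| + 1) * mdist x y `^ k)).
    by apply: ler_wpM2r; [exact: powR_ge0|have := ler_norm L; lra].
  by apply: ler_wpM2l => //; have := normr_ge0 L; lra.
have L1 : `|L| + 1 != 0 by rewrite gt_eqF// ltr_wpDl.
rewrite mulrA [X in X / 2 < _]mulrC divfK//.
by rewrite ltr_pdivrMr// ltr_pMr// ltr1n.
Qed.

Lemma holder_bmeas (X : pmetricType R) s L (f : X -> R) :
  holder s L f -> bounded_measurable (f : borel X -> R).
Proof.
move=> hf; split; first exact: continuous_borelR (holder_continuous hf).
by exists s => x; case: hf.
Qed.

Lemma holder_comp (X Z : pmetricType R) s L (f : X -> Z) (h : Z -> R) :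
  isometric f -> holder s L h -> holder s L (h \o f).
Proof. by move=> isof [hs hL]; split=> [x|x y] /=; [exact: hs|rewrite -isof; exact: hL]. Qed.

Section push.
Variables (X : mcms R) (Z : pmetricType R) (f : X -> Z).
Hypothesis isof : isometric f.

Lemma mcms_finite : (mcms_mu X setT < +oo)%E.
Proof. by have [+ _] := mcms_radon X; apply; exact: mcms_compact. Qed.

Lemma push_integral (h : Z -> R) : bounded_measurable (h : borel Z -> R) ->
  (\int[mcms_push f]_(z in setT) (h z)%:E)%E = (\int[mcms_mu X]_x h (f x))%:E.
Proof.
move=> [mh [C hC]].
have mf : measurable_fun setT (f : borel X -> borel Z).
  exact: continuous_borel (isometric_continuous isof).
have bhf : bounded_measurable (fun x : borel X => h (f x)).
  split; last by exists C => x.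
  have : measurable_fun setT ((h : borel Z -> R) \o (f : borel X -> borel Z)).
    exact: measurableT_comp.
  by [].
rewrite -(bmeas_EFin mcms_finite)// /mcms_push integral_pushforward//.
- exact/measurable_EFinP.
- by rewrite preimage_setT; exact: (bmeas_integrable mcms_finite).
Qed.

End push.

Lemma bl_dist_le (X Y : mcms R) (Z : pmetricType R) (f : X -> Z) (g : Y -> Z) e :
  isometric f -> isometric g ->
  (forall s L (h : Z -> R), 0 <= s -> 0 <= L -> s + L <= 1 -> holder s L h ->
    `|\int[mcms_mu X]_x h (f x) - \int[mcms_mu Y]_y h (g y)| <= e) ->
  (bl_dist k (mcms_push f) (mcms_push g) <= e%:E)%E.
Proof.
move=> isof isog H; apply: ge_ereal_sup => _ [h /= /bl_norm_le1P + <-].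
move=> [s [L [s0 L0 sL hh]]]; have bh := holder_bmeas hh.
by rewrite !push_integral// -EFinB lee_fin; exact: H hh.
Qed.

Lemma le_bl_dist (X Y : mcms R) (Z : pmetricType R) (f : X -> Z) (g : Y -> Z) s L
    (h : Z -> R) :
  isometric f -> isometric g -> 0 <= s -> 0 <= L -> s + L <= 1 -> holder s L h ->
  (`|\int[mcms_mu X]_x h (f x) - \int[mcms_mu Y]_y h (g y)|%:E
    <= bl_dist k (mcms_push f) (mcms_push g))%E.
Proof.
move=> isof isog s0 L0 sL hh; have bh := holder_bmeas hh.
apply: ereal_sup_ubound; exists h; last by rewrite !push_integral// -EFinB.
by apply/bl_norm_le1P; exists s, L.
Qed.

Lemma hausdorff_dist_le (Z : metricType R) (A B : set Z) e :
  (forall a, A a -> exists2 b, B b & mdist a b <= e) ->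
  (forall b, B b -> exists2 a, A a & mdist a b <= e) ->
  (hausdorff_dist A B <= e%:E)%E.
Proof.
move=> AB BA; rewrite ge_max; apply/andP; split; apply: ge_ereal_sup => _ [x xA <-].
- have [y yB xy] := AB x xA; apply: (@le_trans _ _ (mdist x y)%:E) => //.
  by apply: ereal_inf_lbound; exists y.
- have [y yA xy] := BA x xA; apply: (@le_trans _ _ (mdist y x)%:E) => //.
  by apply: ereal_inf_lbound; exists y.
Qed.

Lemma lt_hausdorff_dist (Z : metricType R) (A B : set Z) e :
  (hausdorff_dist A B < e%:E)%E ->
  (forall a, A a -> exists2 b, B b & mdist a b < e) /\
  (forall b, B b -> exists2 a, A a & mdist a b < e).
Proof.
rewrite gt_max => /andP[h1 h2]; split=> x xA.
- have : (ereal_inf [set (mdist x b)%:E | b in B] < e%:E)%E.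
    by apply: le_lt_trans h1; apply: ereal_sup_ubound; exists x.
  by move/ereal_inf_lt => [_ [y yB <-]]; rewrite lte_fin; exists y.
- have : (ereal_inf [set (mdist a x)%:E | a in A] < e%:E)%E.
    by apply: le_lt_trans h2; apply: ereal_sup_ubound; exists x.
  by move/ereal_inf_lt => [_ [y yB <-]]; rewrite lte_fin; exists y.
Qed.

Lemma hausdorff_dist_ge0 (Z : metricType R) (A B : set Z) :
  A !=set0 -> (0 <= hausdorff_dist A B)%E.
Proof.
move=> [a Aa]; rewrite le_max; apply/orP; left.
apply: le_trans (ereal_sup_ubound _); last by exists a.
by apply: le_ereal_inf_tmp => _ [b _ <-]; rewrite lee_fin mdist_ge0.
Qed.

End borel.

(** * Gluing two compact metric spaces *)
Section gluing.
Context (R : realType).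

(** These are the axioms on cross distances [r x y] under which the metrics of [X] and [Y],
    completed by [r], form a pseudometric on the disjoint sum. *)
Record coupling (X Y : metricType R) (r : X -> Y -> R) : Prop := Coupling {
  coupling_ge0 : forall x y, 0 <= r x y;
  coupling_lel : forall x x' y, r x y <= mdist x x' + r x' y;
  coupling_ler : forall x y y', r x y <= r x y' + mdist y' y;
  coupling_distl : forall x x' y, mdist x x' <= r x y + r x' y;
  coupling_distr : forall x y y', mdist y y' <= r x y + r x y' }.

(** The identification of the disjoint sum is the union of two compact isometric copies,
    hence compact. *)
Lemma gluing (X Y : pmetricType R) (r : X -> Y -> R) :
  compact [set: X] -> compact [set: Y] -> coupling r ->
  exists (Z : pmetricType R) (f : X -> Z) (g : Y -> Z),
    [/\ compact [set: Z], isometric f, isometric g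
      & forall x y, mdist (f x) (g y) = r x y].
Proof.
move=> cX cY [r0 rl rr rdl rdr].
pose d (u v : X + Y) : R := match u, v with
  | inl x, inl x' => mdist x x' | inr y, inr y' => mdist y y'
  | inl x, inr y => r x y | inr y, inl x => r x y end.
have dxx u : d u u = 0 by case: u => ? /=; exact: mdistxx.
have dsym u v : d u v = d v u by by case: u v => [x|y] [x'|y'] //=; exact: metric_sym.
have dtri v u w : d u w <= d u v + d v w.
  case: u v w => [x|y] [x'|y'] [x''|y''] /=; rewrite ?metric_triangle//.
  - by rewrite addrC (metric_sym x').
  - by rewrite (metric_sym y) addrC.
(* The ascription of [x0] fixes the universe of the disjoint sum. *)
pose x0 : X := point.
have [Z [p [ps pd]]] := @metric_identification R (X + Y)%type
  (@Pseudometric R (X + Y)%type d (inl x0) dxx dsym dtri).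
have isof : isometric (p \o inl) by move=> x x' /=; rewrite pd.
have isog : isometric (p \o inr) by move=> y y' /=; rewrite pd.
exists Z, (p \o inl), (p \o inr); split => //; last by move=> x y /=; rewrite pd.
rewrite (_ : setT = range (p \o inl) `|` range (p \o inr)).
  by apply: compactU; apply: continuous_compact => //;
    apply/continuous_subspaceT; exact: isometric_continuous.
apply/seteqP; split=> // z _.
by case: (ps z) => -[x|y] <-; [left; exists x|right; exists y].
Qed.

(** If [a] and [b] are two images of the same index set whose distances differ by at most
    [2 * d], then a bridge of length [d] between [a i] and [b i] for each [i]
    creates no shortcut inside [X] or [Y]; [r x y] is the length of the shortest path
    that crosses one bridge. *)
Lemma coupling_family (X Y : metricType R) (I : Type) (i0 : I) (a : I -> X)
    (b : I -> Y) (d : R) :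
  0 <= d -> (forall i j, mdist (a i) (a j) <= mdist (b i) (b j) + 2 * d) ->
  (forall i j, mdist (b i) (b j) <= mdist (a i) (a j) + 2 * d) ->
  exists2 r : X -> Y -> R, coupling r
    & (forall x y i, r x y <= mdist x (a i) + d + mdist (b i) y) /\
      (forall x y m, (forall i, m <= mdist x (a i) + d + mdist (b i) y) -> m <= r x y).
Proof.
move=> d0 ab ba; pose r x y := inf (range (fun i => mdist x (a i) + d + mdist (b i) y)).
have rle x y i : r x y <= mdist x (a i) + d + mdist (b i) y.
  by apply: (inf_range_le (m := 0)) => j; rewrite !addr_ge0// mdist_ge0.
have ler x y m : (forall i, m <= mdist x (a i) + d + mdist (b i) y) -> m <= r x y.
  by move=> h; exact: le_inf_range.
exists r; split => //.
- by move=> x y; apply: (ler) => i; rewrite !addr_ge0// mdist_ge0.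
- move=> x x' y; rewrite -lerBlDl; apply: (ler) => i.
  by have := rle x y i; have := metric_triangle x x' (a i); lra.
- move=> x y y'; rewrite -lerBlDr; apply: (ler) => i.
  by have := rle x y i; have := metric_triangle (b i) y' y; lra.
- move=> x x' y; rewrite -lerBlDr; apply: (ler) => i; rewrite lerBlDr -lerBlDl.
  apply: ler => j; have := ab i j; have := metric_triangle (b i) y (b j).
  have := metric_triangle x (a i) x'; have := metric_triangle (a i) (a j) x'.
  by rewrite (metric_sym y) (metric_sym (a j) x'); lra.
- move=> x y y'; rewrite -lerBlDr; apply: (ler) => i; rewrite lerBlDr -lerBlDl.
  apply: ler => j; have := ba i j; have := metric_triangle (a i) x (a j).
  have := metric_triangle y (b i) y'; have := metric_triangle (b i) (b j) y'.
  by rewrite (metric_sym (a i) x) (metric_sym y (b i)); lra.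
Qed.

End gluing.

(** * The distance in terms of relations between points *)
Section correspondence.
Context (R : realType) (k : R).
Hypothesis k01 : 0 < k <= 1.
Local Notation holder := (holder k).

(** The distortion bound is [2 * d], so that bridges of length [d] are admissible
    in [coupling_family]. *)
Record correspondence (X Y : metricType R) (d : R) (S : X -> Y -> Prop) : Prop :=
  Correspondence {
    corr_left : forall x, exists y, S x y;
    corr_right : forall y, exists x, S x y;
    corr_distl : forall x y x' y', S x y -> S x' y' ->
      mdist x x' <= mdist y y' + 2 * d;
    corr_distr : forall x y x' y', S x y -> S x' y' ->
      mdist y y' <= mdist x x' + 2 * d }.

(** McShane's formula on the graph of [S], with [mdist x x' + d] as the distance from
    [x] to the pair [(x', y')]: the added [d] absorbs the distortion. *)
Lemma holder_transfer (X Y : pmetricType R) (d : R) (S : X -> Y -> Prop)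
    (s L : R) (h : Y -> R) :
  0 <= d -> 0 <= L -> correspondence d S -> holder s L h ->
  exists2 h' : X -> R, holder s L h'
    & forall x y, S x y -> `|h' x - h y| <= L * d `^ k.
Proof.
move=> d0 L0 [Sl Sr dl dr] [hs hL].
have [y0 xy0] := Sl point.
pose T := {p : X * Y | S p.1 p.2}.
have D0 x (t : T) : 0 <= mdist x (sval t).1 + d by rewrite addr_ge0// mdist_ge0.
have [] := @mcshane _ _ k01 T X (exist _ (point, y0) xy0)
  (fun t => h (sval t).2) (fun x t => mdist x (sval t).1 + d) s L L0 D0.
- by move=> t; exact: hs.
- move=> x [[x1 y1] /= S1] [[x2 y2] /= S2].
  apply: le_trans (ler_norm _) _; apply: le_trans (hL _ _) _.
  apply: ler_wpM2l => //; apply: powR_le => //; first exact: mdist_ge0.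
  have := dr _ _ _ _ S1 S2; have := metric_triangle x1 x x2.
  by rewrite (metric_sym x1 x); lra.
move=> h' [h's h'L h'h]; exists h'.
  split=> // x x'; apply: h'L; first exact: mdist_ge0.
    by move=> t; have := metric_triangle x x' (sval t).1; lra.
  by move=> t; have := metric_triangle x' x (sval t).1; rewrite (metric_sym x' x); lra.
move=> x y xy; have := h'h x (exist _ (x, y) xy).
by rewrite /= mdistxx add0r.
Qed.

Lemma holder_extension (X Z : pmetricType R) (f : X -> Z) (s L : R) (h : X -> R) :
  0 <= L -> isometric f -> holder s L h ->
  exists2 H : Z -> R, holder s L H & forall x, H (f x) = h x.
Proof.
move=> L0 isof [hs hL].
have [||H [Hs HL Hh]] := @mcshane _ _ k01 X Z point h
  (fun z x => mdist z (f x)) s L L0 _ hs.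
- by move=> z x; exact: mdist_ge0.
- move=> z x x'; apply: le_trans (ler_norm _) _; apply: le_trans (hL x x') _.
  apply: ler_wpM2l => //; apply: powR_le => //; first exact: mdist_ge0.
  have := metric_triangle (f x) z (f x').
  by rewrite isof (metric_sym (f x) z).
have k0 : k != 0 by case/andP: k01 => /gt_eqF ->.
exists H.
  split=> // z z'; apply: HL; first exact: mdist_ge0.
    by move=> x; have := metric_triangle z z' (f x); lra.
  by move=> x; have := metric_triangle z' z (f x); rewrite (metric_sym z' z); lra.
move=> x; have := Hh (f x) x; rewrite /= mdistxx powR0// mulr0 normr_le0.
by rewrite subr_eq0 => /eqP.
Qed.

Local Notation E X h := (\int[mcms_mu X]_x h x).
Local Notation mass X := (fine (mcms_mu X setT)).

Lemma mass_ge0 (X : mcms R) : 0 <= mass X.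
Proof. exact: fine_ge0. Qed.

Lemma holder_int_dist (X : mcms R) s L s' L' (h h' : X -> R) (c : R) :
  holder s L h -> holder s' L' h' -> (forall x, `|h x - h' x| <= c) ->
  `|E X h - E X h'| <= c * mass X.
Proof.
move=> /(holder_bmeas k01) bh /(holder_bmeas k01) bh'.
exact: (bmeas_int_dist (mcms_finite X) bh bh').
Qed.

(** Bounds on real numbers witnessed by an actual ambient space replace extended-real
    infima and suprema in all later arguments. *)
Definition realized_within (X Y : mcms R) (e : R) : Prop :=
  exists (Z : pmetricType R) (f : X -> Z) (g : Y -> Z),
  [/\ compact [set: Z], isometric f, isometric g,
      (forall x, exists y, mdist (f x) (g y) <= e) /\
      (forall y, exists x, mdist (f x) (g y) <= e)
    & forall (s L : R) (h : Z -> R), 0 <= s -> 0 <= L -> s + L <= 1 ->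
        holder s L h -> `|E X (h \o f) - E Y (h \o g)| <= e].

Lemma mcms_dist_le (X Y : mcms R) (e : R) :
  realized_within X Y e -> (mcms_dist k X Y <= e%:E)%E.
Proof.
move=> [Z [f [g [cZ isof isog [fg gf] H]]]].
apply: (@le_trans _ _ (maxe (hausdorff_dist (range f) (range g))
                   (bl_dist k (mcms_push f) (mcms_push g)))).
  by apply: ereal_inf_lbound; exists Z, f, g.
rewrite ge_max; apply/andP; split; last exact: (bl_dist_le k01).
apply: hausdorff_dist_le => _ [x _ <-].
  by have [y xy] := fg x; exists (g y); [exists y|].
by have [y xy] := gf x; exists (f y); [exists y|].
Qed.

Lemma mcms_dist_lt (X Y : mcms R) (e : R) :
  (mcms_dist k X Y < e%:E)%E -> realized_within X Y e.
Proof.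
move=> /ereal_inf_lt [_ [Z [f [g [cZ isof isog ->]]]]].
rewrite gt_max => /andP[/lt_hausdorff_dist [fg gf] bl].
exists Z, f, g; split=> //.
  split=> [x|y].
    by have [|_ [y _ <-] /ltW xy] := fg (f x); [exists x|exists y].
  by have [|_ [x _ <-] /ltW xy] := gf (g y); [exists y|exists x].
move=> s L h s0 L0 sL hh; have := le_bl_dist k01 isof isog s0 L0 sL hh.
by move=> /le_lt_trans /(_ bl); rewrite lte_fin => /ltW.
Qed.

(** Bridges of length [d] over [S] give the ambient space; a test function on it, restricted
    to [X] and [Y], yields two functions that differ by at most [d `^ k] along [S]. *)
Lemma mcms_dist_le_correspondence (X Y : mcms R) (d e : R) (S : X -> Y -> Prop) :
  0 <= d -> correspondence d S ->
  (forall (s L : R) h1 h2, 0 <= s -> 0 <= L -> s + L <= 1 -> holder s L h1 -> holder s L h2 ->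
    (forall x y, S x y -> `|h1 x - h2 y| <= d `^ k) -> `|E X h1 - E Y h2| <= e) ->
  (mcms_dist k X Y <= (Num.max d e)%:E)%E.
Proof.
move=> d0 cS HS; have [Sl Sr dl dr] := cS; have [y0 xy0] := Sl point.
pose T := {p : X * Y | S p.1 p.2}.
have [||r cr [rle _]] := @coupling_family R X Y T (exist _ (point, y0) xy0)
  (fun t => (sval t).1) (fun t => (sval t).2) d d0.
- by move=> [[x y] /= xy] [[x' y'] /= xy']; exact: dl.
- by move=> [[x y] /= xy] [[x' y'] /= xy']; exact: dr.
have [Z [f [g [cZ isof isog fg]]]] := gluing (@mcms_compact R X) (@mcms_compact R Y) cr.
have rS x y : S x y -> mdist (f x) (g y) <= d.
  by move=> xy; have := rle x y (exist _ (x, y) xy); rewrite fg /= !mdistxx addr0 add0r.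
apply: mcms_dist_le; exists Z, f, g; split=> //.
  split=> [x|y].
    by have [y xy] := Sl x; exists y; rewrite le_max rS.
  by have [x xy] := Sr y; exists x; rewrite le_max rS.
move=> s L h s0 L0 sL hh; rewrite le_max; apply/orP; right.
apply: (HS s L (h \o f) (h \o g)) => //; try exact: holder_comp.
move=> x y /rS xy /=; case: hh => _ /(_ (f x) (g y)) /le_trans; apply.
apply: (@le_trans _ _ (1 * mdist (f x) (g y) `^ k)).
  by apply: ler_wpM2r; [exact: powR_ge0|lra].
by rewrite mul1r; apply: powR_le => //; exact: mdist_ge0.
Qed.

(** Given [h1] on [X], extend it to [H] on the ambient space.  The distance controls
    the difference between the integrals of [H] over [X] and over [Y], and on [Y] the
    functions [H] and [h2] are uniformly close, as every point of [Y] is near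
    a point of [X]. *)
Lemma mcms_dist_lt_coupling (X Y : mcms R) (e : R) :
  (mcms_dist k X Y < e%:E)%E ->
  exists r : X -> Y -> R, [/\ coupling r, forall x, exists y, r x y <= e,
    forall y, exists x, r x y <= e
    & forall (s L : R) h1 h2 (c : R), 0 <= s -> 0 <= L -> s + L <= 1 ->
      holder s L h1 -> holder s L h2 ->
      (forall x y, r x y <= e -> `|h1 x - h2 y| <= c) ->
      `|E X h1 - E Y h2| <= e + (c + 2 * e `^ k) * mass Y].
Proof.
move=> /mcms_dist_lt [Z [f [g [cZ isof isog [lft rgt] bl]]]].
exists (fun x y => mdist (f x) (g y)).
split => //.
  split.
  - by move=> *; exact: mdist_ge0.
  - by move=> x x' y; rewrite -isof metric_triangle.
  - by move=> x y y'; rewrite -isog metric_triangle.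
  - by move=> x x' y; rewrite -isof (metric_sym (f x')) metric_triangle.
  - by move=> x y y'; rewrite -isog (metric_sym (f x) (g y)) metric_triangle.
move=> s L h1 h2 c s0 L0 sL hh1 hh2 hc.
have L1 : L <= 1 by lra.
have [H Hh Hf] := holder_extension L0 isof hh1.
have hHg := holder_comp isog Hh.
have e0 : 0 <= e.
  by have [y] := lft point; apply: le_trans; exact: mdist_ge0.
have ek0 := powR_ge0 e k.
have h12 : `|E X h1 - E Y (H \o g)| <= e.
  have := bl s L H s0 L0 sL Hh.
  by under eq_Rintegral do rewrite /= Hf.
have h22 : `|E Y (H \o g) - E Y h2| <= (c + 2 * e `^ k) * mass Y.
  apply: (holder_int_dist hHg hh2) => y /=.
  have [x xy] := rgt y.
  have h1x : `|h1 x - h2 y| <= c by exact: hc.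
  have Hx : `|H (f x) - H (g y)| <= e `^ k.
    case: Hh => _ /(_ (f x) (g y)) /le_trans; apply.
    apply: (@le_trans _ _ (1 * mdist (f x) (g y) `^ k)).
      by apply: ler_wpM2r => //; exact: powR_ge0.
    by rewrite mul1r; apply: (powR_le k01); [exact: mdist_ge0|].
  have := ler_distD (h1 x) (H (g y)) (h2 y).
  by rewrite Hf distrC in Hx; lra.
have := ler_distD (E Y (H \o g)) (E X h1) (E Y h2); lra.
Qed.

End correspondence.

(** * Finiteness, symmetry and the triangle inequality *)
Section distance.
Context (R : realType) (k : R).
Hypothesis k01 : 0 < k <= 1.
Local Notation holder := (holder k).
Local Notation E X h := (\int[mcms_mu X]_x h x).
Local Notation mass X := (fine (mcms_mu X setT)).
Implicit Types X Y W : mcms R.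

Lemma mcms_dist_ge0 X Y : (0 <= mcms_dist k X Y)%E.
Proof.
apply: le_ereal_inf_tmp => _ [Z [f [g [_ _ _ ->]]]]; rewrite le_max.
by rewrite hausdorff_dist_ge0//; exists (f point), point.
Qed.

Lemma realized_within_sym X Y e : realized_within k X Y e -> realized_within k Y X e.
Proof.
move=> [Z [f [g [cZ isof isog [fg gf] H]]]]; exists Z, g, f; split => //.
  split=> [y|x].
    by have [x xy] := gf y; exists x; rewrite metric_sym.
  by have [y xy] := fg x; exists y; rewrite metric_sym.
by move=> s L h s0 L0 sL hh; rewrite distrC; exact: H hh.
Qed.

Lemma mcms_dist_le_eps X Y W (a : \bar R) :
  (0 <= a)%E -> (forall e : R, (a < e%:E)%E -> realized_within k X W e) ->
  (mcms_dist k X W <= a)%E.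
Proof.
case: a => [a| |//] a0 H; last by rewrite leey.
apply/lee_addgt0Pr => e e0; rewrite -EFinD; apply: (mcms_dist_le k01).
by apply: H; rewrite lte_fin ltrDl.
Qed.

Lemma mcms_dist_sym X Y : mcms_dist k X Y = mcms_dist k Y X.
Proof.
have le X' Y' : (mcms_dist k X' Y' <= mcms_dist k Y' X')%E.
  apply: (mcms_dist_le_eps X) => [|e /(mcms_dist_lt k01)]; first exact: mcms_dist_ge0.
  exact: realized_within_sym.
by apply/eqP; rewrite eq_le !le.
Qed.

(** The two ambient spaces are glued along the copies of [Y]: bridges of length zero join
    the two copies of each point, so these copies coincide in the result. *)
Lemma realized_within_trans X Y W e e' :
  realized_within k X Y e -> realized_within k Y W e' ->
  realized_within k X W (e + e').
Proof.
move=> [Z1 [f1 [g1 [cZ1 isof1 isog1 [fg1 gf1] H1]]]].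
move=> [Z2 [f2 [g2 [cZ2 isof2 isog2 [fg2 gf2] H2]]]].
pose y0 : Y := point.
have [||r cr [rle _]] := @coupling_family R Z1 Z2 Y y0 g1 f2 0 (lexx 0).
- by move=> i j; rewrite isog1 isof2 mulr0 addr0.
- by move=> i j; rewrite isog1 isof2 mulr0 addr0.
have [Z [p [q [cZ isop isoq pq]]]] := gluing cZ1 cZ2 cr.
have rY y : q (f2 y) = p (g1 y).
  apply: esym; apply: mdist_positivity; rewrite pq; apply/eqP; rewrite eq_le.
  by rewrite (coupling_ge0 cr) andbT; have := rle (g1 y) (f2 y) y; rewrite !mdistxx !addr0.
have dp x y : mdist (p (f1 x)) (q (f2 y)) = mdist (f1 x) (g1 y) by rewrite rY isop.
exists Z, (p \o f1), (q \o g2); split => //.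
- by move=> x x' /=; rewrite isop isof1.
- by move=> x x' /=; rewrite isoq isog2.
- split=> [x|w].
    have [y xy] := fg1 x; have [w yw] := fg2 y; exists w.
    rewrite (le_trans (metric_triangle _ (q (f2 y)) _))//=.
    by rewrite isoq dp lerD.
  have [y yw] := gf2 w; have [x xy] := gf1 y; exists x.
  rewrite (le_trans (metric_triangle _ (q (f2 y)) _))//=.
  by rewrite isoq dp lerD.
move=> s L h s0 L0 sL hh.
have h1 := H1 s L _ s0 L0 sL (holder_comp isop hh).
have h2 := H2 s L _ s0 L0 sL (holder_comp isoq hh).
have eY : E Y ((h \o q) \o f2) = E Y ((h \o p) \o g1).
  by apply: eq_Rintegral => y _ /=; rewrite rY.
rewrite eY in h2; apply: le_trans (ler_distD (E Y ((h \o p) \o g1)) _ _) _.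
exact: lerD.
Qed.

Lemma compact_bounded (X : pmetricType R) : compact [set: X] ->
  exists2 M : R, 0 <= M & forall x y : X, mdist x y <= M.
Proof.
move=> cX; have [n [a an]] := finite_net cX (@ltr01 R).
have S0 : 0 <= \sum_i mdist (a ord0) (a i).
  by apply: sumr_ge0 => i _; exact: mdist_ge0.
exists (2 * (1 + \sum_i mdist (a ord0) (a i))); first by rewrite mulr_ge0// addr_ge0.
have h x : mdist (a ord0) x <= 1 + \sum_i mdist (a ord0) (a i).
  have [i ix] := an x; have := metric_triangle (a ord0) (a i) x.
  have : mdist (a ord0) (a i) <= \sum_i mdist (a ord0) (a i).
    by rewrite (bigD1 i)//= lerDl; apply: sumr_ge0 => j _; exact: mdist_ge0.
  lra.
move=> x y; have := h x; have := h y; have := metric_triangle x (a ord0) y.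
by rewrite (metric_sym x (a ord0)); lra.
Qed.

(** The total relation between two bounded spaces has finite distortion. *)
Lemma mcms_dist_lty X Y : (mcms_dist k X Y < +oo)%E.
Proof.
have [M M0 hM] := compact_bounded (@mcms_compact _ X).
have [N N0 hN] := compact_bounded (@mcms_compact _ Y).
apply: (@le_lt_trans _ _ (Num.max (M + N) (mass X + mass Y))%:E); last exact: ltry.
apply: (mcms_dist_le_correspondence k01 (S := fun _ _ => True)); first exact: addr_ge0.
  split=> [x|y|x y x' y' _ _|x y x' y' _ _]; first by exists point.
  - by exists point.
  - by have := hM x x'; have := mdist_ge0 y y'; lra.
  - by have := hN y y'; have := mdist_ge0 x x'; lra.
move=> s L h1 h2 s0 L0 sL hh1 hh2 _.
have h0 (Z : mcms R) : holder s L (fun=> 0 : R) (Z := Z).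
  by split=> *; rewrite ?subrr normr0// mulr_ge0// powR_ge0.
have bd (Z : mcms R) (h : Z -> R) : holder s L h -> `|E Z h| <= mass Z.
  move=> hh; have := holder_int_dist k01 (c := 1) hh (h0 Z).
  rewrite bmeas_int_cst mul0r subr0 mul1r; apply=> x.
  by rewrite subr0; have [+ _] := hh => /(_ x); lra.
by rewrite (le_trans (ler_normB _ _))// lerD// bd.
Qed.

Lemma mcms_dist_triangle X Y W :
  (mcms_dist k X W <= mcms_dist k X Y + mcms_dist k Y W)%E.
Proof.
have fin X' Y' : mcms_dist k X' Y' \is a fin_num.
  by rewrite ge0_fin_numE ?mcms_dist_ge0// mcms_dist_lty.
apply: (mcms_dist_le_eps X); first by rewrite adde_ge0// mcms_dist_ge0.
move=> e; rewrite -(fineK (fin X Y)) -(fineK (fin Y W)) -EFinD lte_fin.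
set a := fine _; set b := fine _ => abe.
have -> : e = (a + (e - a - b) / 2) + (b + (e - a - b) / 2) by lra.
apply: (@realized_within_trans X Y W); apply: (mcms_dist_lt k01).
  by rewrite -(fineK (fin X Y)) -/a lte_fin; lra.
by rewrite -(fineK (fin Y W)) -/b lte_fin; lra.
Qed.

Lemma mcms_equiv_refl X : mcms_equiv X X.
Proof. by exists id; split=> //; rewrite image_id. Qed.

Lemma mcms_equiv_dist0 X Y : mcms_equiv X Y -> mcms_dist k X Y = 0%E.
Proof.
move=> [phi [isophi surj pushE]]; apply/eqP; rewrite eq_le mcms_dist_ge0 andbT.
have k0 : k != 0 by case/andP: k01 => /gt_eqF ->.
rewrite -[X in (_ <= X)%E]/(0%:E) -[X in (_ <= X%:E)%E](maxxx (0 : R)).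
apply: (mcms_dist_le_correspondence k01 (S := fun x y => phi x = y)) => //.
  split=> [x|y|x _ x' _ <- <-|x _ x' _ <- <-]; first by exists (phi x).
  - by have : [set: Y] y by []; rewrite -surj => -[x _ <-]; exists x.
  - by rewrite isophi; lra.
  - by rewrite isophi; lra.
move=> s L h1 h2 s0 L0 sL hh1 hh2; rewrite powR0// => h12.
have e12 : h1 = h2 \o phi.
  apply/funext => x; apply/eqP; rewrite -subr_eq0 -normr_le0.
  exact: h12.
have bh2 := holder_bmeas k01 hh2.
rewrite e12 normr_le0 subr_eq0; apply/eqP/EFin_inj.
rewrite -(bmeas_EFin (mcms_finite Y) bh2) -(push_integral isophi bh2).
apply: eq_measure_integral; first exact: continuous_borel (isometric_continuous isophi).
by move=> mphi A mA _; exact: (pushE A mA).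
Qed.

End distance.

(** * Hölder functions determine finite Borel measures *)
Section holderian.
Context (R : realType) (k : R).
Hypothesis k01 : 0 < k <= 1.
Context (Z : pmetricType R).
Implicit Types f g : Z -> R.

Definition holderian f := exists C : R, holder k C C f.

Lemma holder_weaken s L s' L' f : s <= s' -> L <= L' -> holder k s L f ->
  holder k s' L' f.
Proof.
move=> ss LL [fs fL]; split=> [x|x y]; first exact: le_trans (fs x) ss.
by apply: le_trans (fL x y) _; rewrite ler_wpM2r// powR_ge0.
Qed.

Lemma holderian_cst (c : R) : holderian (fun=> c).
Proof.
exists `|c|; split=> // x y; rewrite subrr normr0 mulr_ge0//; exact: powR_ge0.
Qed.

Let holderian_comp2 (op : R -> R -> R) f g :
  (forall a b, `|op a b| <= `|a| + `|b|) ->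
  (forall a b a' b', `|op a b - op a' b'| <= `|a - a'| + `|b - b'|) ->
  holderian f -> holderian g -> holderian (fun x => op (f x) (g x)).
Proof.
move=> op1 op2 [C [fC fL]] [D [gD gL]]; exists (C + D); split=> [x|x y].
  by apply: le_trans (op1 _ _) _; rewrite lerD.
by apply: le_trans (op2 _ _ _ _) _; rewrite mulrDl lerD.
Qed.

Lemma holderianD f g : holderian f -> holderian g -> holderian (fun x => f x + g x).
Proof.
apply: (@holderian_comp2 +%R) => [a b|a b a' b']; first exact: ler_normD.
by rewrite opprD addrACA; exact: ler_normD.
Qed.

Lemma holderianZ c f : holderian f -> holderian (fun x => c * f x).
Proof.
move=> [C [fC fL]]; exists (`|c| * C); split=> [x|x y].
  by rewrite normrM ler_wpM2l.
by rewrite -mulrBr normrM -mulrA ler_wpM2l.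
Qed.

Lemma holderianB f g : holderian f -> holderian g -> holderian (fun x => f x - g x).
Proof.
move=> hf /(holderianZ (-1)) hg; have := holderianD hf hg.
by under eq_fun do rewrite mulN1r.
Qed.

Lemma holderian_min f g : holderian f -> holderian g ->
  holderian (fun x => Num.min (f x) (g x)).
Proof.
apply: holderian_comp2 => [a b|a b a' b'].
  by have [_|_] := leP a b; rewrite ?lerDl ?lerDr.
have h1 := normr_ge0 (a - a'); have h2 := normr_ge0 (b - b').
have l1 := ler_norm (a - a'); have l2 := ler_norm (b - b').
have l3 := ler_norm (- (a - a')); have l4 := ler_norm (- (b - b')).
rewrite !normrN in l3 l4.
rewrite ler_norml; have [?|?] := leP a b; have [?|?] := leP a' b'; lra.
Qed.

Lemma holderian_max f g : holderian f -> holderian g ->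
  holderian (fun x => Num.max (f x) (g x)).
Proof.
move=> hf hg; have := holderianB (holderianD hf hg) (holderian_min hf hg).
by under eq_fun do rewrite -[X in X - _]addr_max_min addrK.
Qed.

(** At distances at most 1 use [d <= d `^ k]; at larger distances use the bound on [f]. *)
Lemma holderian_lipschitz f (C L : R) : 0 <= L -> (forall x, `|f x| <= C) ->
  (forall x y, `|f x - f y| <= L * mdist x y) -> holderian f.
Proof.
move=> L0 fC fL; have C0 : 0 <= C by apply: le_trans (fC point).
exists (2 * C + L); split=> [x|x y]; first by have := fC x; lra.
have [xy0|xy0] := eqVneq (mdist x y) 0.
  have -> : x = y by exact: mdist_positivity.
  by rewrite subrr normr0 mulr_ge0// ?powR_ge0//; lra.
have xy : 0 < mdist x y by rewrite lt_neqAle eq_sym xy0 mdist_ge0.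
have [xy1|/ltW xy1] := leP (mdist x y) 1.
  have d : mdist x y <= mdist x y `^ k.
    by apply: ger1_powR; [rewrite xy|case/andP: k01].
  apply: le_trans (fL x y) _; rewrite mulrDl.
  have := ler_wpM2l L0 d; have := mulr_ge0 C0 (powR_ge0 (mdist x y) k).
  lra.
have d : 1 <= mdist x y `^ k.
  by have := powR_le k01 ler01 xy1; rewrite powR1.
have : `|f x - f y| <= 2 * C by have := ler_normB (f x) (f y); have := fC x; have := fC y; lra.
have := ler_wpM2l C0 d; have := ler_wpM2l L0 d; rewrite mulrDl; lra.
Qed.

Lemma holderian_bmeas f : holderian f -> bounded_measurable (f : borel Z -> R).
Proof. by move=> [C hf]; exact: holder_bmeas hf. Qed.

Lemma holderian_continuous f : holderian f -> continuous f.
Proof. by move=> [C hf]; exact: holder_continuous hf. Qed.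

End holderian.

Section bump.
Context (R : realType) (Z : pmetricType R).

(** The distance to the complement of [U], cut off at 1; the value 1 also keeps the
    infimum meaningful when [U] is the whole space. *)
Definition codist (U : set Z) (x : Z) : R :=
  inf [set r | r = 1 \/ exists2 y, ~ U y & r = mdist x y].

(** These functions increase with [n] to the indicator function of an open set [U]. *)
Definition bump (U : set Z) (n : nat) (x : Z) : R := Num.min 1 (n%:R * codist U x).

Variable U : set Z.

Let codist_lb x : has_lbound [set r : R | r = 1 \/ exists2 y, ~ U y & r = mdist x y].
Proof. by exists 0 => _ [->|[y _ ->]]; [exact: ler01|exact: mdist_ge0]. Qed.

Lemma le_codist x m : m <= 1 -> (forall y, ~ U y -> m <= mdist x y) ->
  m <= codist U x.
Proof.
move=> m1 my; apply: lb_le_inf; first by exists 1; left.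
by move=> _ [->|[y Uy ->]] //; exact: my.
Qed.

Lemma codist_le1 x : codist U x <= 1.
Proof. by apply: ge_inf => //; left. Qed.

Lemma codist_le x y : ~ U y -> codist U x <= mdist x y.
Proof. by move=> Uy; apply: ge_inf => //; right; exists y. Qed.

Lemma codist_ge0 x : 0 <= codist U x.
Proof. by apply: le_codist => [|y _]; [exact: ler01|exact: mdist_ge0]. Qed.

Lemma codist_eq0 x : ~ U x -> codist U x = 0.
Proof.
move=> Ux; apply/eqP; rewrite eq_le codist_ge0 andbT.
by rewrite -(mdistxx x); exact: codist_le.
Qed.

Lemma codist_gt0 x : open U -> U x -> 0 < codist U x.
Proof.
move=> oU Ux; have : nbhs x U by exact: open_nbhs_nbhs.
rewrite -nbhs_ballE => -[e /= e0]; rewrite ballEmdist => eU.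
apply: (@lt_le_trans _ _ (Num.min 1 e)); first by rewrite lt_min ltr01.
apply: le_codist => [|y Uy]; first by rewrite ge_min lexx.
rewrite ge_min; apply/orP; right; rewrite leNgt; apply/negP => xy.
exact/Uy/eU.
Qed.

Lemma codist_lip x y : codist U x <= codist U y + mdist x y.
Proof.
rewrite -lerBlDr; apply: le_codist => [|z Uz].
  by have := codist_le1 x; have := mdist_ge0 x y; lra.
by have := codist_le x Uz; have := metric_triangle x y z; lra.
Qed.

Lemma bump_ge0 n x : 0 <= bump U n x.
Proof. by rewrite /bump le_min ler01/= mulr_ge0// codist_ge0. Qed.

Lemma bump_le1 n x : bump U n x <= 1.
Proof. by rewrite /bump ge_min lexx. Qed.

Lemma bump_eq0 n x : ~ U x -> bump U n x = 0.
Proof. by move=> Ux; rewrite /bump codist_eq0// mulr0 min_r. Qed.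

Lemma bump_nd n m x : (n <= m)%N -> bump U n x <= bump U m x.
Proof.
move=> nm; rewrite /bump le_min ge_min lexx/= ge_min; apply/orP; right.
by rewrite ler_wpM2r ?codist_ge0// ler_nat.
Qed.

Lemma bump_eq1 x : open U -> U x -> exists N, forall n, (N <= n)%N -> bump U n x = 1.
Proof.
move=> oU Ux; have c0 := codist_gt0 oU Ux.
exists (Num.truncn (codist U x)^-1).+1 => n Nn; rewrite /bump min_l//.
rewrite -ler_pdivrMr// div1r; apply: (@le_trans _ _ (Num.truncn (codist U x)^-1).+1%:R).
  by apply/ltW; exact: truncnS_gt.
by rewrite ler_nat.
Qed.

Lemma bump_holderian (k : R) n : 0 < k <= 1 -> holderian k (bump U n).
Proof.
move=> k01; apply: (holderian_lipschitz k01 (C := 1) (L := n%:R)) => //.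
  by move=> x; rewrite ger0_norm ?bump_ge0// bump_le1.
have lip x y : bump U n x <= bump U n y + n%:R * mdist x y.
  have h := ler_wpM2l (ler0n R n) (codist_lip x y).
  have h' := mulr_ge0 (ler0n R n) (mdist_ge0 x y).
  rewrite /bump; have [?|?] := leP 1 (n%:R * codist U x).
    by have [?|?] := leP 1 (n%:R * codist U y); lra.
  by have [?|?] := leP 1 (n%:R * codist U y); lra.
move=> x y; rewrite ler_norml; have := lip x y; have := lip y x.
by rewrite (metric_sym y x); lra.
Qed.

End bump.

Section measure_eq.
Context (R : realType) (k : R).
Hypothesis k01 : 0 < k <= 1.

(** By monotone convergence along the bump functions, the two measures agree on open
    sets, which generate the Borel sets and are stable under intersection. *)
Lemma finite_measure_eq (Z : pmetricType R)
    (m1 m2 : {measure set (borel Z) -> \bar R}) :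
  (m1 setT < +oo)%E ->
  (forall f : Z -> R, holderian k f ->
    (\int[m1]_x (f x)%:E = \int[m2]_x (f x)%:E)%E) ->
  forall B : set (borel Z), measurable B -> m1 B = m2 B.
Proof.
move=> m1fin H; apply: (@measure_unique _ _ (borel Z) open (fun=> setT)) => //.
- exact: openI.
- by move=> _; exact: openT.
- by apply/seteqP; split=> // x _; exists 0%N.
move=> U oU; have mU := open_borel oU.
have lim (m : {measure set (borel Z) -> \bar R}) :
    (\int[m]_x (bump U n x)%:E)%E @[n --> \oo] --> m U.
  have <- : (\int[m]_x (\1_U x)%:E = m U)%E by rewrite integral_indic// setIT.
  rewrite [X in _ --> X](_ : _ = (\int[m]_x limn (fun n => (bump U n x)%:E))%E).
    apply: cvg_monotone_convergence => //.
    - move=> n; apply/measurable_EFinP.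
      by case: (holderian_bmeas k01 (bump_holderian U n k01)).
    - by move=> n x _; rewrite lee_fin bump_ge0.
    - by move=> x _ n n' nn'; rewrite lee_fin bump_nd.
  apply: eq_integral => x _; apply/esym/cvg_lim => //.
  have [Ux|Ux] := pselect (U x).
    have [N hN] := bump_eq1 oU Ux; rewrite indicE mem_set//.
    apply: cvg_near_cst; near=> n; rewrite hN//; near: n.
    exact: nbhs_infty_ge.
  rewrite indicE memNset//; apply: cvg_near_cst; near=> n.
  by rewrite bump_eq0.
rewrite -(cvg_lim (@ereal_hausdorff R) (lim m1)) -(cvg_lim (@ereal_hausdorff R) (lim m2)).
by congr (limn _); apply/funext => n; exact: H (bump_holderian U n k01).
Unshelve. all: by end_near. Qed.

End measure_eq.

(** * Spaces at distance zero are equivalent *)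
Section separation.
Context (R : realType) (k : R).
Hypothesis k01 : 0 < k <= 1.
Local Notation holder := (holder k).
Local Notation E X h := (\int[mcms_mu X]_x h x).
Local Notation mass X := (fine (mcms_mu X setT)).

Lemma eq_small (a b C : R) : (forall e, 0 < e -> `|a - b| <= C * e) -> a = b.
Proof.
move=> H; apply/eqP; rewrite -subr_eq0 -normr_le0; apply/ler_addgt0Pr => e e0.
have C1 : 0 < `|C| + 1 by rewrite ltr_wpDl.
have := H (e / (`|C| + 1)) (divr_gt0 e0 C1); rewrite add0r => /le_trans; apply.
rewrite mulrCA -[X in _ <= X]mulr1 ler_wpM2l ?(ltW e0)//.
by rewrite ler_pdivrMr// mul1r; have := ler_norm C; lra.
Qed.

Lemma holderian_unit (Z : pmetricType R) (f : Z -> R) : holderian k f ->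
  exists (c : R) (g : Z -> R), holder (1 / 2) (1 / 2) g /\ f = (fun x => c * g x).
Proof.
move=> [C [fC fL]]; have C0 : 0 <= C by apply: le_trans (fC point).
pose c := 2 * (C + 1); have c0 : 0 < c by rewrite /c; lra.
exists c, (fun x => c^-1 * f x); split; last first.
  by apply/funext => x; rewrite mulrA divff ?mul1r// gt_eqF.
have h : c^-1 * C <= 1 / 2.
  by rewrite mulrC ler_pdivrMr// /c; lra.
split=> [x|x y].
  rewrite normrM gtr0_norm ?invr_gt0//; apply: le_trans h.
  by rewrite ler_wpM2l// ltW// invr_gt0.
rewrite -mulrBr normrM gtr0_norm ?invr_gt0//.
apply: (@le_trans _ _ (c^-1 * C * mdist x y `^ k)).
  by rewrite -mulrA ler_wpM2l// ltW// invr_gt0.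
by rewrite ler_wpM2r// powR_ge0.
Qed.

Lemma pushforward_eq (X : mcms R) (Z : pmetricType R) (f : X -> Z)
    (m : {measure set (borel Z) -> \bar R}) : isometric f -> (m setT < +oo)%E ->
  (forall h, holder (1 / 2) (1 / 2) h -> E X (h \o f) = \int[m]_z h z) ->
  forall B : set (borel Z), measurable B -> mcms_push f B = m B.
Proof.
move=> isof mfin H B mB; apply/esym.
have mf := continuous_borel (isometric_continuous isof).
apply: (finite_measure_eq k01 (m1 := m)) => // h hh.
have [c [g [hg ->]]] := holderian_unit hh.
have bg := holder_bmeas k01 hg.
rewrite (bmeas_EFin mfin (bmeasZ c bg)) (bmeas_intZ mfin c bg) -H//.
rewrite (push_integral isof (bmeasZ c bg)).
have bgf := holder_bmeas k01 (holder_comp isof hg).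
by rewrite (bmeas_intZ (mcms_finite X) c bgf).
Qed.

(** For [x] in [X], let [y n x] be related to [x] at scale [e n], and let [phi x] be the limit
    of [y n x] along a free ultrafilter.  Distances pass to the limit, so [phi] is isometric;
    limits of points of [X] related to a given [b] show that it is onto.  A finite net of [X]
    makes the convergence to [phi] uniform over [X]; then [h \o phi] and [h] almost
    agree along the relation, and their integrals coincide in the limit. *)
Lemma mcms_dist0_equiv (X Y : mcms R) : mcms_dist k X Y = 0%E -> mcms_equiv X Y.
Proof.
move=> d0; pose e (n : nat) : R := n.+1%:R^-1.
have e_gt0 n : 0 < e n by rewrite invr_gt0.
have d0e n : (mcms_dist k X Y < (e n)%:E)%E by rewrite d0 lte_fin.
have /choice[r hr] (n : nat) := mcms_dist_lt_coupling k01 (d0e n).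
have [U UU sU] := free_ultrafilter.
have FU : Filter U by exact: filter_filter.
have meet A B C : U A -> U B -> U C -> exists n, [/\ A n, B n & C n].
  move=> UA UB UC; have [n [[? ?] ?]] := filter_ex (filterI (filterI UA UB) UC).
  by exists n.
have eU c : 0 < c -> U [set n | e n < c].
  by move=> c0; apply: sU; exact: (near_infty_natSinv_lt (PosNum c0)).
have /choice[y hy] (nx : nat * X) : exists y, r nx.1 nx.2 y <= e nx.1.
  by have [_ + _ _] := hr nx.1 => /(_ nx.2).
have /choice[x hx] (ny : nat * Y) : exists x, r ny.1 x ny.2 <= e ny.1.
  by have [_ _ + _] := hr ny.1 => /(_ ny.2).
have /choice[phi hphi] (a : X) := ultra_cvg (fun n => y (n, a)) UU (@mcms_compact _ Y).
have yy n a b : mdist (y (n, a)) b <= e n + r n a b.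
  have [cr _ _ _] := hr n; have h := hy (n, a).
  by have := coupling_distr cr a (y (n, a)) b; lra.
have isophi : isometric phi.
  move=> a b; apply: (@eq_small _ _ 4) => c c0.
  have [n [/= ha hb hn]] := meet _ _ _ (hphi a c c0) (hphi b c c0) (eU c c0).
  have [cr _ _ _] := hr n; have h1 := hy (n, a); have h2 := hy (n, b).
  have h3 := coupling_distl cr a b (y (n, a)); have h4 := yy n a (y (n, b)).
  have h5 := coupling_lel cr a b (y (n, b)); have h6 := coupling_ler cr b (y (n, a)) (y (n, b)).
  have h7 := metric_triangle (phi a) (y (n, a)) (phi b).
  have h8 := metric_triangle (y (n, a)) (y (n, b)) (phi b).
  have h9 := metric_triangle (y (n, a)) (phi a) (y (n, b)).
  have h10 := metric_triangle (phi a) (phi b) (y (n, b)).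
  rewrite (metric_sym (y (n, b)) (phi b)) in h8; rewrite (metric_sym (y (n, a)) (phi a)) in h9.
  rewrite (metric_sym (y (n, b)) (y (n, a))) in h6.
  by rewrite ler_norml /= in h1 h2 *; lra.
have unif c : 0 < c -> U [set n | forall a, mdist (phi a) (y (n, a)) <= c].
  move=> c0; have c5 : 0 < c / 5 by rewrite divr_gt0.
  have [N [a ha]] := finite_net (@mcms_compact _ X) c5.
  have aU : U [set n | forall i, mdist (phi (a i)) (y (n, a i)) < c / 5].
    by apply: filter_forall => i; exact: hphi.
  apply: filterS (filterI aU (eU _ c5)) => n [/= hn en] b; have [i ib] := ha b.
  have [cr _ _ _] := hr n; have h1 := hy (n, a i); have h2 := hy (n, b).
  have := hn i; have := metric_triangle (phi b) (phi (a i)) (y (n, b)).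
  have := metric_triangle (phi (a i)) (y (n, a i)) (y (n, b)).
  have := yy n (a i) (y (n, b)); have := coupling_lel cr (a i) b (y (n, b)).
  by rewrite isophi (metric_sym b (a i)) /= in h1 h2 *; lra.
exists phi; split => //.
  apply/seteqP; split=> // b _.
  have [a ha] := ultra_cvg (fun n => x (n, b)) UU (@mcms_compact _ X).
  exists a => //; apply: mdist_positivity; apply: (@eq_small _ _ 4) => c c0.
  have [n [/= h1 h2 h3]] := meet _ _ _ (hphi a c c0) (ha c c0) (eU c c0).
  have [cr _ _ _] := hr n; have h4 := hx (n, b); have h5 := yy n a b.
  have h6 := coupling_lel cr a (x (n, b)) b.
  have h7 := metric_triangle (phi a) (y (n, a)) b.
  by rewrite subr0 ger0_norm ?mdist_ge0//= in h4 *; lra.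
apply: pushforward_eq => //; first exact: mcms_finite.
move=> h hh; apply: (@eq_small _ _ (1 + 3 * mass Y)) => c c0.
have [b b0 bc] := powR_small k01 c0.
pose d := Num.min c (b / 3).
have d0' : 0 < d by rewrite lt_min c0 divr_gt0.
have dc : d <= c by rewrite ge_min lexx.
have db : d <= b / 3 by rewrite ge_min lexx orbT.
have [n [/= hn en _]] := meet _ _ _ (unif d d0') (eU d d0') (eU d d0').
have [cr _ _ bl] := hr n.
have half0 : 0 <= 1 / 2 :> R by lra.
have half1 : 1 / 2 + 1 / 2 <= 1 :> R by lra.
have m0 := mass_ge0 Y.
have pk z : 0 <= z -> z <= b -> z `^ k <= c.
  by move=> z0 zb; apply: le_trans bc; exact: powR_le.
have := bl _ _ _ _ c half0 half0 half1 (holder_comp isophi hh) hh _.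
have ek : e n `^ k <= c by apply: pk; [exact: ltW|lra].
have H1 : (c + 2 * e n `^ k) * mass Y <= (c + 2 * c) * mass Y by rewrite ler_wpM2r//; lra.
move=> H2; apply: le_trans (H2 _) _; last by lra.
move=> a a' ra; case: hh => _ /(_ (phi a) a') /le_trans; apply.
have := metric_triangle (phi a) (y (n, a)) a'; have := yy n a a'; have := hn a => ? ? ?.
have h1 : mdist (phi a) a' `^ k <= c by apply: pk; [exact: mdist_ge0|lra].
by have := powR_ge0 (mdist (phi a) a') k; lra.
Qed.

End separation.

(** * Riesz representation of functionals on Hölder functions *)
Section riesz.
Context (R : realType) (k : R).
Hypothesis k01 : 0 < k <= 1.
Context (Z : pmetricType R).
Hypothesis cZ : compact [set: Z].
Local Notation holderian := (holderian k).

Variable I : (Z -> R) -> R.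
Hypothesis I_add : forall f g, holderian f -> holderian g ->
  I (fun x => f x + g x) = I f + I g.
Hypothesis I_scale : forall c f, holderian f -> I (fun x => c * f x) = c * I f.
Hypothesis I_ge0 : forall f, holderian f -> (forall x, 0 <= f x) -> 0 <= I f.

Local Notation I1 := (I (fun=> 1)).

Let I_sub f g : holderian f -> holderian g -> I (fun x => f x - g x) = I f - I g.
Proof.
move=> hf hg; rewrite -[- I g]mulN1r -I_scale// -I_add//; last exact: holderianZ.
by congr I; apply/funext => x; rewrite mulN1r.
Qed.

Let I_le f g : holderian f -> holderian g -> (forall x, f x <= g x) -> I f <= I g.
Proof.
move=> hf hg fg; rewrite -subr_ge0 -I_sub//; apply: I_ge0; first exact: holderianB.
by move=> x; rewrite subr_ge0.
Qed.

Let I_cst c : I (fun=> c) = c * I1.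
Proof.
rewrite -I_scale; last exact: holderian_cst.
by congr I; apply/funext => x; rewrite mulr1.
Qed.

Let I1_ge0 : 0 <= I1.
Proof. by apply: I_ge0 => //; exact: holderian_cst. Qed.

Let I_sum (n : nat) (F : nat -> Z -> R) : (forall i, holderian (F i)) ->
  holderian (fun x => \sum_(i < n) F i x) /\
  I (fun x => \sum_(i < n) F i x) = \sum_(i < n) I (F i).
Proof.
move=> hF; elim: n => [|n [h1 h2]].
  rewrite big_ord0; under eq_fun do rewrite big_ord0.
  split; first exact: holderian_cst.
  by rewrite I_cst mul0r.
rewrite big_ord_recr/= -h2 -I_add//; under eq_fun do rewrite big_ord_recr/=.
by split=> //; exact: holderianD.
Qed.

(** The set where such a function is at least [e > 0] is compact and lies in [U]; this is
    how compactness enters. *)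
Definition subordinate (U : set Z) (f : Z -> R) :=
  [/\ holderian f, forall x, 0 <= f x, forall x, f x <= 1
    & forall x, ~ U x -> f x = 0].

Definition open_content (U : set Z) : R := sup [set I f | f in subordinate U].

Definition outer_content (A : set Z) : R :=
  inf [set open_content U | U in [set U | open U /\ A `<=` U]].

Local Notation lam := open_content.
Local Notation mu := outer_content.

Let sub0 U : subordinate U (fun=> 0).
Proof. by split=> //; exact: holderian_cst. Qed.

Let sub_le U f : subordinate U f -> I f <= I1.
Proof. by move=> [hf _ f1 _]; apply: I_le => //; exact: holderian_cst. Qed.

Let sub_bump U n : subordinate U (bump U n).
Proof.
split; [exact: bump_holderian|by move=> x; exact: bump_ge0|
  by move=> x; exact: bump_le1|by move=> x; exact: bump_eq0].
Qed.

Let lam_sup U : has_sup [set I f | f in subordinate U].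
Proof.
split; first by exists (I (fun=> 0)), (fun=> 0) => //; exact: sub0.
by exists I1 => _ [f hf <-]; exact: sub_le hf.
Qed.

Let le_lam U f : subordinate U f -> I f <= lam U.
Proof. by move=> hf; apply: sup_upper_bound => //; exists f. Qed.

Let lam_le U m : (forall f, subordinate U f -> I f <= m) -> lam U <= m.
Proof.
move=> h; apply: ge_sup; first by case: (lam_sup U).
by move=> _ [f hf <-]; exact: h.
Qed.

Let lam_ge0 U : 0 <= lam U.
Proof. by have := le_lam (sub0 U); rewrite I_cst mul0r. Qed.

Let lam_le1 U : lam U <= I1.
Proof. by apply: lam_le => f; exact: sub_le. Qed.

Let lam_mono U V : U `<=` V -> lam U <= lam V.
Proof.
move=> UV; apply: lam_le => f [hf f0 f1 fU]; apply: le_lam; split => // x Vx.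
by apply: fU => /UV.
Qed.

Let lam_set0 : lam set0 = 0.
Proof.
apply/eqP; rewrite eq_le lam_ge0 andbT; apply: lam_le => f [_ _ _ f0].
have -> : f = fun=> 0 by apply/funext => x; exact: f0.
by rewrite I_cst mul0r.
Qed.

Let lam_setT : lam setT = I1.
Proof.
apply/eqP; rewrite eq_le lam_le1 /=; apply: le_lam.
by split=> [|_|_|x /(_ Logic.I)//]; [exact: holderian_cst|exact: ler01|].
Qed.

(** Lowering [f] by [e] changes [I f] by at most [e * I1], while the result lives on the
    compact set where [f >= e]. *)
Let trim (e : R) (f : Z -> R) x := Num.max (f x - e) 0.

Let trim_holderian e f : holderian f -> holderian (trim e f).
Proof.
move=> hf; apply: holderian_max; last exact: holderian_cst.
by apply: holderianB => //; exact: holderian_cst.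
Qed.

Let trim_I e f : 0 <= e -> holderian f -> I f <= I (trim e f) + e * I1.
Proof.
move=> e0 hf; rewrite -I_cst -I_add; [|exact: trim_holderian|exact: holderian_cst].
apply: I_le => //; first by apply: holderianD; [exact: trim_holderian|exact: holderian_cst].
by move=> x; rewrite -lerBlDr /trim le_max lexx.
Qed.

(** On the compact set where [f >= e], finitely many of the [V i] suffice, and with
    large slopes their bump functions reach 1.  If this failed for all [n], the
    counterexamples would accumulate at a point that lies in some [V i]. *)
Let finite_bumps (V : (set Z)^nat) (f : Z -> R) (e : R) : 0 < e -> (forall n, open (V n)) ->
  continuous f -> (forall x, ~ (\bigcup_n V n) x -> f x = 0) ->
  exists n : nat, forall x, e <= f x -> exists2 i, (i < n)%N & bump (V i) n x = 1.
Proof.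
move=> e0 oV cf fV; apply: contrapT => H.
have /choice[x hx] (n : nat) : exists x, e <= f x /\ forall i, (i < n)%N -> bump (V i) n x <> 1.
  apply: contrapT => h; apply: H; exists n => y ey; apply: contrapT => h'.
  by apply: h; exists y; split=> // i im im1; apply: h'; exists i.
have [U UU sU] := free_ultrafilter.
have FU : Filter U by exact: filter_filter.
have [l hl] := ultra_cvg x UU cZ.
have fl : e <= f l.
  apply/ler_addgt0Pr => c c0.
  have : \forall y \near l, `|f l - f y| < c by apply: cvgr_dist_lt => //; exact: cf.
  move=> /nbhs_ballP [d /= d0]; rewrite ballEmdist => hd.
  have [n /hd/=] := filter_ex (hl d d0).
  by have [+ _] := hx n; rewrite ltr_norml => + /andP[+ +]; lra.
have [i _ Vil] : (\bigcup_n V n) l.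
  by apply: contrapT => /fV f0; move: fl; rewrite f0; lra.
have c0 := codist_gt0 (oV i) Vil; set c := codist (V i) l in c0.
have c2 : 0 < c / 2 by lra.
have big : U [set n | (maxn i.+1 (Num.truncn (c / 2)^-1).+1 <= n)%N].
  by apply: sU; exact: nbhs_infty_ge.
have [n [/= ln]] := filter_ex (filterI (hl _ c2) big).
rewrite geq_max => /andP[im tn]; have [_ /(_ i im)] := hx n; apply.
have cn : c / 2 <= codist (V i) (x n).
  by have := codist_lip (V i) l (x n); rewrite -/c; lra.
rewrite /bump min_l// -ler_pdivrMr ?(lt_le_trans c2)// div1r.
apply: (@le_trans _ _ (c / 2)^-1); first by rewrite lef_pV2 ?posrE// (lt_le_trans c2).
apply: (@le_trans _ _ (Num.truncn (c / 2)^-1).+1%:R); last by rewrite ler_nat.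
by apply/ltW; exact: truncnS_gt.
Qed.

(** After trimming, [f] lies below a finite sum of bump functions subordinate to the [V n]. *)
Let lam_subadditive (V : (set Z)^nat) : (forall n, open (V n)) ->
  ((lam (\bigcup_n V n))%:E <= \sum_(n <oo) (lam (V n))%:E)%E.
Proof.
move=> oV; set S := (\sum_(n <oo) _)%E.
have S0 : (0 <= S)%E by apply: nneseries_ge0 => n _ _; rewrite lee_fin.
case ES : S S0 => [s| |//] S0; last by rewrite leey.
rewrite lee_fin; apply: lam_le => f [hf f0 f1 fV].
have key e : 0 < e -> I f <= s + e * I1.
  move=> e0; have [n hn] := finite_bumps e0 oV (holderian_continuous k01 hf) fV.
  apply: le_trans (trim_I (ltW e0) hf) _; rewrite lerD2r.
  have [hs Is] := I_sum n (fun i => bump_holderian (V i) n k01).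
  apply: (@le_trans _ _ (I (fun x => \sum_(i < n) bump (V i) n x))).
    apply: I_le => // [|x]; first exact: trim_holderian.
    have s0 : 0 <= \sum_(i < n) bump (V i) n x by apply: sumr_ge0 => i _; exact: bump_ge0.
    rewrite /trim ge_max s0 andbT.
    have [/hn [i im bi]|fe] := leP e (f x); last by lra.
    apply: (@le_trans _ _ 1); first by have := f1 x; lra.
    rewrite (bigD1 (Ordinal im))//= bi lerDl.
    by apply: sumr_ge0 => j _; exact: bump_ge0.
  rewrite Is; apply: (@le_trans _ _ (\sum_(i < n) lam (V i))).
    by apply: ler_sum => i _; apply: le_lam; exact: sub_bump.
  rewrite -lee_fin -ES -sumEFin -(big_mkord xpredT (fun i => (lam (V i))%:E)).
  by apply: nneseries_lim_ge => i _; rewrite lee_fin.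
apply/ler_addgt0Pr => e e0.
have J1 : 0 < I1 + 1 by have := I1_ge0; lra.
apply: le_trans (key (e / (I1 + 1)) (divr_gt0 e0 J1)) _; rewrite lerD2l.
by rewrite mulrAC -mulrA ger_pMr// ler_pdivrMr// mul1r; lra.
Qed.

Let mu_inf A : has_inf [set lam U | U in [set U | open U /\ A `<=` U]].
Proof.
split; first by exists (lam setT), setT => //; split=> //; exact: openT.
by exists 0 => _ [U _ <-].
Qed.

Let mu_le A U : open U -> A `<=` U -> mu A <= lam U.
Proof. by move=> oU AU; apply: inf_lbound; [case: (mu_inf A)|exists U]. Qed.

Let le_mu A m : (forall U, open U -> A `<=` U -> m <= lam U) -> m <= mu A.
Proof.
move=> h; apply: lb_le_inf; first by case: (mu_inf A).
by move=> _ [U [oU AU] <-]; exact: h.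
Qed.

Let mu_ge0 A : 0 <= mu A. Proof. by apply: le_mu. Qed.

Let mu_open U : open U -> mu U = lam U.
Proof.
move=> oU; apply/eqP; rewrite eq_le mu_le//=.
by apply: le_mu => V _; exact: lam_mono.
Qed.

Let mu_mono A B : A `<=` B -> mu A <= mu B.
Proof. by move=> AB; apply: le_mu => U oU BU; apply: mu_le => //; exact: subset_trans BU. Qed.

Let mu_approx A e : 0 < e -> exists U, [/\ open U, A `<=` U & lam U < mu A + e].
Proof.
by move=> e0; have [_ [U [oU AU] <-] h] := inf_adherent e0 (mu_inf A); exists U.
Qed.

Let mu_subadditive : sigma_subadditive (fun A => (mu A)%:E).
Proof.
move=> F; apply/lee_addgt0Pr => e e0.
have /choice[U hU] (n : nat) : exists U,
    [/\ open U, F n `<=` U & lam U < mu (F n) + e / (2 ^ n.+1)%:R].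
  by apply: mu_approx; rewrite divr_gt0// ltr0n expn_gt0.
have sub : \bigcup_n F n `<=` \bigcup_n U n.
  by apply: subset_bigcup => n _; have [_ + _] := hU n.
have oU : open (\bigcup_n U n) by apply: bigcup_open => n _; have [+ _ _] := hU n.
apply: (@le_trans _ _ (lam (\bigcup_n U n))%:E); first by rewrite lee_fin mu_le.
have := lam_subadditive (fun n => let: And3 o _ _ := hU n in o).
move=> /le_trans; apply.
apply: le_trans (epsilon_trick _ _ (ltW e0)); last by move=> n; rewrite lee_fin.
apply: lee_nneseries => [n _ _|n _]; first by rewrite lee_fin.
by rewrite -EFinD lee_fin; have [_ _ /ltW] := hU n.
Qed.

Let mu_set0 : mu set0 = 0.
Proof. by rewrite mu_open ?lam_set0//; exact: open0. Qed.

Let mu_outer : {outer_measure set Z -> \bar R} := HB.pack (fun A => (mu A)%:E)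
  (isOuterMeasure.Build R Z (fun A => (mu A)%:E)
    (congr1 EFin mu_set0) (fun A => mu_ge0 A) (fun A B AB => mu_mono AB) mu_subadditive).

(** Take [f] subordinate to [V `&` U] and [g] subordinate to [W], the part of [V] where
    [f < e].  Then [trim e f + g] is subordinate to [V], since its two terms
    are never nonzero at the same point. *)
Let lam_split U V : open U -> open V ->
  lam (V `&` U) + mu (V `&` ~` U) <= lam V.
Proof.
move=> oU oV; rewrite -lerBrDr; apply: lam_le => f [hf f0 f1 fVU].
rewrite lerBrDr -lerBrDl.
apply/ler_addgt0Pr => e' e'0; have J1 : 0 < I1 + 1 by have := I1_ge0; lra.
(* [I1 + 1] instead of [I1], which may vanish. *)
pose e := e' / (I1 + 1); have e0 : 0 < e by exact: divr_gt0.
have eI : e * I1 <= e'.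
  by rewrite /e mulrAC -mulrA ger_pMr// ler_pdivrMr// mul1r; lra.
pose W := V `&` [set x | f x < e].
have oW : open W.
  apply: openI => //; have /continuousP cf := holderian_continuous k01 hf.
  exact: cf (open_lt (y := e)).
have VW : V `&` ~` U `<=` W.
  by move=> x [Vx Ux]; split=> //=; rewrite fVU// => -[].
apply: le_trans (mu_le oW VW) _; apply: lam_le => g [hg g0 g1 gW].
have ht := trim_holderian e hf.
have : I (trim e f) + I g <= lam V.
  rewrite -I_add//; apply: le_lam; split.
  - exact: holderianD.
  - by move=> x; rewrite addr_ge0// /trim le_max lexx orbT.
  - move=> x; rewrite /trim; have [fe|fe] := ltP (f x) e.
      by rewrite max_r ?add0r//; lra.
    rewrite gW ?addr0; last by move=> [_ /=]; lra.
    by rewrite ge_max ler01 andbT; have := f1 x; lra.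
  - move=> x Vx; rewrite gW; last by case.
    by rewrite /trim fVU ?max_r//; [lra|lra|case].
have := trim_I (ltW e0) hf; lra.
Qed.

Let open_caratheodory U : open U -> mu_outer.-caratheodory U.
Proof.
move=> oU; apply: le_caratheodory_measurable => X /=.
rewrite -EFinD lee_fin; apply: le_mu => V oV XV.
apply: le_trans (lam_split oU oV); apply: lerD.
  by apply: mu_le; [exact: openI|exact: setSI].
by apply: mu_mono; exact: setSI.
Qed.

Let borel_caratheodory (A : set (borel Z)) : measurable A -> mu_outer.-caratheodory A.
Proof.
have := @smallest_sub _ (sigma_algebra setT) (@open Z)
  (@measurable _ (caratheodory_type mu_outer)).
apply; last exact: open_caratheodory.
exact: (@sigma_algebra_measurable _ (caratheodory_type mu_outer)).
Qed.

Let mu_sigma_additive : semi_sigma_additive (fun A : set (borel Z) => (mu A)%:E).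
Proof.
move=> F mF tF mUF.
exact: (@caratheodory_measure_sigma_additive _ _ mu_outer F
  (fun n => borel_caratheodory (mF n)) tF
  (borel_caratheodory mUF)).
Qed.

Let m : {measure set (borel Z) -> \bar R} := HB.pack (fun A : set (borel Z) => (mu A)%:E)
  (isMeasure.Build _ _ _ (fun A : set (borel Z) => (mu A)%:E)
    (congr1 EFin mu_set0) (fun A => mu_ge0 A) mu_sigma_additive).

Let m_finite : (m setT < +oo)%E.
Proof. exact: ltry. Qed.

Let m_open U : open U -> fine (m U) = lam U.
Proof. exact: mu_open. Qed.

Let m_setT : fine (m setT) = I1.
Proof. by rewrite m_open ?lam_setT//; exact: openT. Qed.

(** Slices of height one of the number [t]; for [0 <= t <= n] the first [n] of them sum
    to [t]. *)
Let layer (t : R) (i : nat) : R := Num.max 0 (Num.min 1 (t - i%:R)).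

Let sum_layer (t : R) n : 0 <= t -> \sum_(i < n) layer t i = Num.min t n%:R.
Proof.
move=> t0; elim: n => [|n IH]; first by rewrite big_ord0 min_r.
rewrite big_ord_recr/= IH /layer; have n0 := ler0n R n.
rewrite -natr1; have [tn|nt] := leP t n%:R.
  have [?|?] := leP 1 (t - n%:R); first by lra.
  by rewrite max_l; [rewrite min_l; lra|lra].
have [?|?] := leP 1 (t - n%:R); rewrite max_r; try lra.
  by rewrite min_r; lra.
by rewrite min_l; lra.
Qed.

Let sum_level (t : R) n : 0 <= t ->
  \sum_(i < n) (if i%:R < t then 1 else 0) <= Num.min (t + 1) n%:R.
Proof.
move=> t0; elim: n => [|n IH]; first by rewrite big_ord0 le_min lexx andbT; lra.
move: IH; rewrite big_ord_recr/= !le_min -natr1 => /andP[h1 h2].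
by case: ifPn => nt; apply/andP; split; lra.
Qed.

(** Layer cake: cut [N * f] into [N] slices [g i] with values in [0, 1].  The slice [g i] is
    subordinate to the open set [A i] where [N * f] exceeds [i], so [I (g i)] is at most
    the measure of [A i], and the sum of the indicators of the [A i] is at most [N * f + 1]. *)
Let le_integral_I f : holderian f -> (forall x, 0 <= f x) -> (forall x, f x <= 1) ->
  I f <= \int[m]_z f z.
Proof.
move=> hf f0 f1; apply/ler_addgt0Pr => e e0.
(* The overshoot of the [N] indicators costs [I1 / N], at most [e]. *)
pose N := (Num.truncn (I1 / e)).+1; have N0 : 0 < N%:R :> R by rewrite ltr0n.
have IN : I1 <= e * N%:R.
  by rewrite mulrC -ler_pdivrMr//; apply/ltW; exact: truncnS_gt.
pose g i x := layer (N%:R * f x) i.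
have hg i : holderian (g i).
  apply: holderian_max; first exact: holderian_cst.
  apply: holderian_min; first exact: holderian_cst.
  by apply: holderianB; [exact: holderianZ|exact: holderian_cst].
pose A i : set (borel Z) := [set x | i%:R < N%:R * f x].
have oA i : open (A i : set Z).
  have /continuousP cf := holderian_continuous k01 (holderianZ N%:R hf).
  exact: cf (open_gt (y := i%:R)).
have mA i : measurable (A i) by exact: open_borel.
have gA i : I (g i) <= fine (m (A i)).
  rewrite m_open//; apply: le_lam; split => // x.
  - by rewrite /g /layer le_max lexx.
  - by rewrite /g /layer ge_max ler01/= ge_min lexx.
  - rewrite /A /= => /negP; rewrite -leNgt => Nf.
    by rewrite /g /layer max_l// ge_min subr_le0 Nf orbT.
have [_ sumI] := I_sum N hg.
have e1 : N%:R * I f = \sum_(i < N) I (g i).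
  rewrite -I_scale// -sumI; congr I; apply/funext => x.
  by rewrite sum_layer ?mulr_ge0// min_l// ger_pMr.
have bA i : bounded_measurable (\1_(A i) : borel Z -> R) by exact: bmeas_indic.
have e2 : \sum_(i < N) fine (m (A i)) = \int[m]_x (\sum_(i < N) \1_(A i) x).
  rewrite (bmeas_int_sum m_finite)//; apply: eq_bigr => i _.
  by rewrite bmeas_int_indic.
have bf := holderian_bmeas k01 hf.
have e3 : \int[m]_x (\sum_(i < N) \1_(A i) x) <= N%:R * \int[m]_x f x + I1.
  have -> : N%:R * \int[m]_x f x + I1 = \int[m]_x (N%:R * f x + 1).
    rewrite (bmeas_intD m_finite (bmeasZ N%:R bf) (bmeas_cst (borel Z) (1 : R))).
    rewrite (bmeas_intZ m_finite)//.
    by rewrite bmeas_int_cst mul1r m_setT.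
  apply: (bmeas_int_le m_finite).
  - exact: bmeas_sum.
  - by apply: bmeasD; [exact: bmeasZ|exact: bmeas_cst].
  - move=> x; apply: (@le_trans _ _ (\sum_(i < N) (if i%:R < N%:R * f x then 1 else 0))).
      apply: ler_sum => i _; rewrite indicE; case: ifPn => h.
        by case: (_ \in _).
      by rewrite memNset//; exact/negP.
    have := @sum_level (N%:R * f x) N; rewrite le_min mulr_ge0// => /(_ isT).
    by move=> /andP[].
have : \sum_(i < N) I (g i) <= \sum_(i < N) fine (m (A i)) by apply: ler_sum.
rewrite -e1 e2 => /le_trans /(_ e3) h.
rewrite -(ler_pM2l N0) mulrDr; apply: le_trans h _.
by rewrite lerD2l mulrC.
Qed.

(** The inequality for [1 - f] gives the missing direction, since [m] has total
    mass [I1]. *)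
Let integral_unit f : holderian f -> (forall x, 0 <= f x) -> (forall x, f x <= 1) ->
  \int[m]_z f z = I f.
Proof.
move=> hf f0 f1; apply/eqP; rewrite eq_le le_integral_I// andbT.
have h1 := holderian_cst k Z 1.
have := @le_integral_I (fun x => 1 - f x) (holderianB h1 hf).
rewrite I_sub// (bmeas_intB m_finite (bmeas_cst (borel Z) (1 : R)) (holderian_bmeas k01 hf)).
rewrite bmeas_int_cst mul1r m_setT => h.
suff : I1 - I f <= I1 - \int[m]_z f z by lra.
by apply: h => x; have := f0 x; have := f1 x; lra.
Qed.

Let integral_I f : holderian f -> \int[m]_z f z = I f.
Proof.
move=> /(holderian_unit) [c [g [hg ->]]].
have hg' : holderian g by exists (1 / 2).
have bg := holderian_bmeas k01 hg'.
rewrite (bmeas_intZ m_finite)// I_scale//; congr (_ * _).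
have h12 := holderian_cst k Z (1 / 2).
have := @integral_unit (fun x => g x + 1 / 2) (holderianD hg' h12).
rewrite I_add// (bmeas_intD m_finite bg (bmeas_cst (borel Z) _)) bmeas_int_cst m_setT.
rewrite (I_cst (1 / 2)) => h; apply: (addIr (1 / 2 * I1)); apply: h => x.
  by have [+ _] := hg => /(_ x); rewrite ler_norml; lra.
by have [+ _] := hg => /(_ x); rewrite ler_norml; lra.
Qed.

(** The measure is outer regular by construction; complements of open sets are compact,
    so taking complements gives inner regularity. *)
Let m_radon : radon (T := Z) m.
Proof.
split=> [C _|A mA]; first exact: ltry.
have muC (B : set (borel Z)) : measurable B -> mu B + mu (~` B) = I1.
  move=> mB; have /(_ setT) := borel_caratheodory mB.
  by rewrite !setTI /= -EFinD => -[<-]; rewrite mu_open ?lam_setT//; exact: openT.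
apply/eqP; rewrite eq_le; apply/andP; split; last first.
  by apply: ge_ereal_sup => _ [C [_ CA] <-]; rewrite lee_fin; exact: mu_mono.
apply/lee_addgt0Pr => e e0.
have [U [oU AU Ue]] := mu_approx (~` A) e0.
have CA : ~` U `<=` A by rewrite -[A]setCK; exact: subsetC.
have cC : compact (~` U).
  by apply: (subclosed_compact _ cZ) => //; exact: open_closedC.
apply: (@le_trans _ _ ((mu (~` U))%:E + e%:E)%E).
  rewrite -EFinD lee_fin; have := muC A mA.
  have := muC U (open_borel oU); rewrite (mu_open oU); lra.
by apply: leeD => //; apply: ereal_sup_ubound; exists (~` U).
Qed.

(** Bump functions are Hölder, so the values of [I] on Hölder functions determine a
    content on open sets; Carathéodory's construction turns it into the measure. *)
Theorem riesz_holderian : exists m : {measure set (borel Z) -> \bar R},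
  radon (T := Z) m /\ forall f, holderian f -> \int[m]_z f z = I f.
Proof. by exists m; split; [exact: m_radon|exact: integral_I]. Qed.

End riesz.

(** * Completeness *)
Section threads.

Lemma thread_from (T : nat -> Type) (P : forall n, T n -> T n.+1 -> Prop) :
  (forall n x, exists y, P n x y) -> forall x : T 0%N,
  exists t : forall n, T n, t 0%N = x /\ forall n, P n (t n) (t n.+1).
Proof.
move=> Pl x; pose F n (y : T n) : T n.+1 := projT1 (cid (Pl n y)).
have FP n y : P n y (F n y) := projT2 (cid (Pl n y)).
exists (fix t n : T n := match n with 0%N => x | m.+1 => F m (t m) end).
by split=> // n; exact: FP.
Qed.

(** Forward from [y] by recursion; backwards from [x], one step for each index below [n],
    whence the induction on [n] over shifted sequences of types. *)
Lemma thread_through (T : nat -> Type) (P : forall n, T n -> T n.+1 -> Prop) :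
  (forall n x, exists y, P n x y) -> (forall n y, exists x, P n x y) ->
  forall n (x : T n) (y : T n.+1), P n x y ->
  exists t : forall n, T n, [/\ t n = x, t n.+1 = y & forall n, P n (t n) (t n.+1)].
Proof.
move=> + + n; elim: n T P => [|n IH] T P Pl Pr x y xy.
  have [t [t0 Pt]] := @thread_from (fun n => T n.+1) (fun n => @P n.+1) (fun n => @Pl n.+1) y.
  exists (fun n => match n with 0%N => x | m.+1 => t m end).
  by split=> // -[|m] //=; rewrite t0.
have [t [tx ty Pt]] := IH (fun n => T n.+1) (fun n => @P n.+1) (fun n => @Pl n.+1)
  (fun n => @Pr n.+1) x y xy.
have [z zt] := Pr 0%N (t 0%N).
exists (fun n => match n with 0%N => z | m.+1 => t m end).
by split=> // -[|m] //=.
Qed.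

End threads.

Section geometric_limit.
Context (R : realType).

(** The intervals of radius [2 * e n] around [v n] are nested, so the infimum of their upper
    ends lies in all of them; the bound on the rate is what the later estimates need. *)
Lemma geometric_limit (v e : nat -> R) :
  (forall n, 0 <= e n) -> (forall n, 2 * e n.+1 <= e n) ->
  (forall n, `|v n - v n.+1| <= e n) -> exists l, forall n, `|v n - l| <= 2 * e n.
Proof.
move=> e0 e2 ve.
have mono m n : (m <= n)%N -> `|v m - v n| <= 2 * e m - 2 * e n.
  move=> /subnKC <-; elim: (n - m)%N => [|p IH]; first by rewrite addn0 !subrr normr0.
  rewrite addnS; have := ler_distD (v (m + p)%N) (v m) (v (m + p).+1).
  by have := ve (m + p)%N; have := e2 (m + p)%N; lra.
have cmp m n : v m - 2 * e m <= v n + 2 * e n.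
  have := e0 m; have := e0 n; case: (leqP m n) => [|/ltnW] /mono;
  rewrite ler_norml => /andP[]; lra.
exists (inf (range (fun n => v n + 2 * e n))) => n.
have h1 : inf (range (fun n => v n + 2 * e n)) <= v n + 2 * e n.
  exact: (inf_range_le _ (cmp 0%N)).
have h2 : v n - 2 * e n <= inf (range (fun n => v n + 2 * e n)).
  exact: (le_inf_range 0%N (cmp n)).
by rewrite ler_norml; lra.
Qed.

Definition eta (n : nat) : R := (1 / 2) ^+ n.

Lemma eta_gt0 n : 0 < eta n. Proof. by rewrite exprn_gt0//; lra. Qed.

Lemma etaS n : eta n = 2 * eta n.+1.
Proof. by rewrite /eta exprS; lra. Qed.

Lemma eta_small (e : R) : 0 < e -> exists n, eta n < e.
Proof.
move=> e0; have [n _ h] := near_infty_natSinv_expn_lt (PosNum e0).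
by exists n; have := h n (leqnn n); rewrite /eta expr_div_n expr1n.
Qed.

Lemma le_eta (a b C : R) : (forall n, a <= b + C * eta n) -> a <= b.
Proof.
move=> H; apply/ler_addgt0Pr => e e0; have C1 : 0 < `|C| + 1 by rewrite ltr_wpDl.
have [n hn] := eta_small (divr_gt0 e0 C1); apply: le_trans (H n) _.
rewrite lerD2l; move: hn; rewrite ltr_pdivlMr// => /ltW; apply: le_trans.
by rewrite mulrC ler_wpM2l ?(ltW (eta_gt0 n))//; have := ler_norm C; lra.
Qed.

End geometric_limit.

Section complete_fast.
Context (R : realType) (k : R).
Hypothesis k01 : 0 < k <= 1.
Local Notation holder := (holder k).
Local Notation holderian := (holderian k).
Local Notation E X h := (\int[mcms_mu X]_x h x).
Local Notation mass X := (fine (mcms_mu X setT)).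
Local Notation eta := (eta R).

(** The ratio is chosen such that [(ratio ^+ n) `^ k] is [eta n]: both the scales and
    their powers of exponent [k] then decay geometrically. *)
Definition ratio : R := (1 / 2) `^ k^-1.

Let k_gt0 : 0 < k. Proof. by case/andP: k01. Qed.

Lemma ratio_gt0 : 0 < ratio. Proof. by apply: powR_gt0; lra. Qed.

Lemma ratio_le : ratio <= 1 / 2.
Proof.
apply: ge1r_powR; first by apply/andP; split; lra.
by rewrite invf_ge1//; case/andP: k01.
Qed.

Lemma ratioX_gt0 n : 0 < ratio ^+ n.
Proof. by rewrite exprn_gt0// ratio_gt0. Qed.

Lemma ratioX_le n : ratio ^+ n <= eta n.
Proof. by apply: lerXn2r; rewrite ?nnegrE ?(ltW ratio_gt0) ?ratio_le//; lra. Qed.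

Lemma ratioX_powR n : (ratio ^+ n) `^ k = eta n.
Proof.
elim: n => [|n IH]; first by rewrite /eta !expr0 powR1.
rewrite exprS powRM ?(ltW ratio_gt0) ?(ltW (ratioX_gt0 n))// IH /eta exprS.
by congr (_ * _); rewrite /ratio -powRrM mulVf ?gt_eqF// powRr1//; lra.
Qed.

Lemma ratioX2 n : 2 * ratio ^+ n.+1 <= ratio ^+ n.
Proof.
rewrite exprS mulrA -[X in _ <= X]mul1r ler_wpM2r//; first exact/ltW/ratioX_gt0.
by have := ratio_le; lra.
Qed.

Lemma mass_dist (X Y : mcms R) (e : R) : (mcms_dist k X Y < e%:E)%E ->
  `|mass X - mass Y| <= e.
Proof.
move=> /(mcms_dist_lt k01) [Z [f [g [_ _ _ _ /(_ 1 0 (fun=> 1))]]]].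
rewrite !bmeas_int_cst !mul1r; apply; rewrite ?ler01 ?addr0//.
by split=> *; rewrite ?normr1// subrr normr0 mul0r.
Qed.

Variable X : nat -> mcms R.
Hypothesis X_fast : forall n, (mcms_dist k (X n) (X n.+1) < (ratio ^+ n)%:E)%E.

Let M : R := mass (X 0%N) + 2.

Let mass_le n : mass (X n) <= M.
Proof.
(* The steps sum to at most 2; what remains after stage [n] is [2 * eta n]. *)
suff : mass (X n) <= mass (X 0%N) + 2 - 2 * eta n.
  by have := eta_gt0 R n; rewrite /M; lra.
elim: n => [|n IH]; first by rewrite /eta expr0; lra.
have := mass_dist (X_fast n); rewrite ler_norml => /andP[h _].
by have := ratioX_le n; have := etaS R n; lra.
Qed.

Let M_ge0 : 0 <= M. Proof. exact: le_trans (mass_ge0 (X 0%N)) (mass_le 0). Qed.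

Variable r : forall n, X n -> X n.+1 -> R.
Hypothesis r_coupling : forall n, coupling (@r n).
Hypothesis r_left : forall n x, exists y, @r n x y <= ratio ^+ n.
Hypothesis r_right : forall n y, exists x, @r n x y <= ratio ^+ n.
Hypothesis r_int : forall n (s L : R) h1 h2 (c : R), 0 <= s -> 0 <= L -> s + L <= 1 ->
  holder s L h1 -> holder s L h2 ->
  (forall x y, @r n x y <= ratio ^+ n -> `|h1 x - h2 y| <= c) ->
  `|E (X n) h1 - E (X n.+1) h2| <= ratio ^+ n + (c + 2 * (ratio ^+ n) `^ k) * mass (X n.+1).

(** The points of the limit space are represented by these sequences. *)
Definition thread := {t : forall n, X n | forall n, r (t n) (t n.+1) <= ratio ^+ n}.

Let thread_edge n (x : X n) (y : X n.+1) : r x y <= ratio ^+ n ->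
  exists t : thread, sval t n = x /\ sval t n.+1 = y.
Proof.
move=> xy; have [t [tx ty Pt]] := @thread_through (fun n => X n)
  (fun n x y => r x y <= ratio ^+ n) r_left r_right n x y xy.
by exists (exist _ t Pt).
Qed.

Let thread_at n (x : X n) : exists t : thread, sval t n = x.
Proof. by have [y /thread_edge [t [tx _]]] := r_left x; exists t. Qed.

Let dist_cvg (t t' : thread) : exists l, forall n,
  `|mdist (sval t n) (sval t' n) - l| <= 4 * ratio ^+ n.
Proof.
have [n|n|n|l hl] := @geometric_limit R (fun n => mdist (sval t n) (sval t' n))
  (fun n => 2 * ratio ^+ n).
- by have := ratioX_gt0 n; lra.
- by have := ratioX2 n; lra.
- have c := r_coupling n; case: t t' => [t tP] [t' t'P] /=.
  have h1 := coupling_distl c (t n) (t' n) (t' n.+1).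
  have h2 := coupling_ler c (t n) (t' n.+1) (t n.+1).
  have h3 := coupling_distr c (t n) (t n.+1) (t' n.+1).
  have h4 := coupling_lel c (t n) (t' n) (t' n.+1).
  by have := tP n; have := t'P n; rewrite ler_norml; lra.
by exists l => n; have := hl n; lra.
Qed.

Definition thread_dist (t t' : thread) : R := projT1 (cid (dist_cvg t t')).

Let thread_distP t t' n : `|mdist (sval t n) (sval t' n) - thread_dist t t'| <= 4 * ratio ^+ n.
Proof. by rewrite /thread_dist; case: cid. Qed.

Let le_ratio (a b C : R) : 0 <= C -> (forall n, a <= b + C * ratio ^+ n) -> a <= b.
Proof.
move=> C0 H; apply: (@le_eta _ _ _ C) => n; apply: le_trans (H n) _.
by rewrite lerD2l ler_wpM2l// ratioX_le.
Qed.

Let thread_distxx t : thread_dist t t = 0.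
Proof.
apply/eqP; rewrite -normr_le0; apply: (@le_ratio _ _ 4) => // n.
by have := thread_distP t t n; rewrite mdistxx sub0r normrN; lra.
Qed.

Let thread_dist_sym t t' : thread_dist t t' = thread_dist t' t.
Proof.
have le a b : thread_dist a b <= thread_dist b a.
  apply: (@le_ratio _ _ 8) => // n; have := thread_distP a b n; have := thread_distP b a n.
  by rewrite metric_sym !ler_norml; lra.
by apply/eqP; rewrite eq_le !le.
Qed.

Let thread_dist_triangle b a c : thread_dist a c <= thread_dist a b + thread_dist b c.
Proof.
apply: (@le_ratio _ _ 12) => // n; have := thread_distP a b n; have := thread_distP b c n.
have := thread_distP a c n; have := metric_triangle (sval a n) (sval b n) (sval c n).
by rewrite !ler_norml; lra.
Qed.

Let thread0 : thread := projT1 (cid (@thread_at 0%N point)).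

Lemma thread_space : exists (Q : pmetricType R) (p : thread -> Q),
  (forall q, exists t, p t = q) /\
  forall t t', mdist (p t) (p t') = thread_dist t t'.
Proof.
exact: (@metric_identification R thread
  (@Pseudometric R thread thread_dist thread0 thread_distxx thread_dist_sym
    thread_dist_triangle)).
Qed.

Variables (Q : pmetricType R) (p : thread -> Q).
Hypothesis p_surj : forall q, exists t, p t = q.
Hypothesis p_dist : forall t t', mdist (p t) (p t') = thread_dist t t'.

Let Q_compact : compact [set: Q].
Proof.
rewrite compact_ultra => F UF _; have FF : Filter F by exact: filter_filter.
have /choice[s hs] := p_surj.
pose cv n := cid (ultra_cvg (fun q => sval (s q) n) UF (@mcms_compact _ (X n))).
pose x n : X n := projT1 (cv n).
have hx n e : 0 < e -> F [set q | mdist (x n) (sval (s q) n) < e] := projT2 (cv n) e.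
have xP n : r (x n) (x n.+1) <= ratio ^+ n.
  apply/ler_addgt0Pr => e e0; have e2 : 0 < e / 2 by rewrite divr_gt0.
  have [q [/= h1 h2]] := filter_ex (filterI (hx n _ e2) (hx n.+1 _ e2)).
  have := svalP (s q) n; have c := r_coupling n.
  have := coupling_lel c (x n) (sval (s q) n) (x n.+1).
  have := coupling_ler c (sval (s q) n) (x n.+1) (sval (s q) n.+1).
  by rewrite (metric_sym _ (x n.+1)); lra.
exists (p (exist _ x xP)); split=> // A /nbhs_ballP[e /= e0]; rewrite ballEmdist => eA.
have e8 : 0 < e / 8 by rewrite divr_gt0.
have [n hn] := eta_small e8; apply: filterS (hx n _ e8) => q /= xq.
apply: eA => /=; rewrite -(hs q) p_dist.
have := thread_distP (exist _ x xP) (s q) n; rewrite /= ler_norml.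
by have := ratioX_le n; lra.
Qed.

(** This relation between [X n] and the limit space has distortion of order [ratio ^+ n],
    by the rate of convergence in [thread_distP]. *)
Definition passes n (x : X n) (q : Q) : Prop := exists t : thread, sval t n = x /\ p t = q.

Let passes_corr n : correspondence (2 * ratio ^+ n) (@passes n).
Proof.
split=> [x|q|x q x' q'|x q x' q'].
- by have [t tx] := thread_at x; exists (p t), t.
- by have [t tq] := p_surj q; exists (sval t n), t.
- move=> [t [<- <-]] [t' [<- <-]]; rewrite p_dist.
  by have := thread_distP t t' n; rewrite ler_norml; lra.
- move=> [t [<- <-]] [t' [<- <-]]; rewrite p_dist.
  by have := thread_distP t t' n; rewrite ler_norml; lra.
Qed.

Let delta_powR n : (2 * ratio ^+ n) `^ k <= 2 * eta n.
Proof.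
rewrite powRM ?(ltW (ratioX_gt0 n))// ratioX_powR ler_wpM2r ?(ltW (eta_gt0 R n))//.
by apply: ler1_powR; [lra|case/andP: k01].
Qed.

(** A Hölder function [h] on the limit space is seen on [X n] through functions [u n] with
    the same kind of bounds.  They are compared with [h] along threads, which is a uniform
    comparison because a thread passes through each point of [X n]. *)
Definition approximates (C : R) (u : forall n, X n -> R) (h : Q -> R) : Prop :=
  0 < C /\ forall n, holder C C (u n) /\
    forall t : thread, `|u n (sval t n) - h (p t)| <= C * eta n.

Let approx_exists C h : 0 < C -> holder C C h -> exists u, approximates (2 * C) u h.
Proof.
move=> C0 hh; have d0 n : 0 <= 2 * ratio ^+ n by have := ratioX_gt0 n; lra.
pose tr n := cid2 (holder_transfer k01 (d0 n) (ltW C0) (passes_corr n) hh).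
exists (fun n => s2val (tr n)); split; first by lra.
move=> n; split.
  by apply: holder_weaken (s2valP (tr n)); lra.
move=> t; have := s2valP' (tr n) (sval t n) (p t) (ex_intro _ t (conj erefl erefl)).
move=> /le_trans; apply; have := ler_wpM2l (ltW C0) (delta_powR n); lra.
Qed.

Let rate (C : R) : R := 2 * C * (1 + 3 * M).

Let approx_bmeas C u h n : approximates C u h -> bounded_measurable (u n : borel (X n) -> R).
Proof. by move=> [_ /(_ n) [hu _]]; exact: holder_bmeas hu. Qed.

(** A thread joins any two points that are related at stage [n], so [u n] and [u n.+1]
    almost agree along the relation.  Dividing by [2 * C] brings both functions into the
    unit ball. *)
Let approx_step C u h n : approximates C u h ->
  `|E (X n) (u n) - E (X n.+1) (u n.+1)| <= rate C * eta n.
Proof.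
move=> au; have [C0 uP] := au; have C2 : 0 < 2 * C by lra.
have half (m : nat) : holder (1 / 2) (1 / 2) (fun x => (2 * C)^-1 * u m x).
  have [[us uL] _] := uP m; have e : (2 * C)^-1 * C = 1 / 2.
    by rewrite invfM -mulrA mulVf ?mulr1 ?div1r// gt_eqF.
  have i0 : 0 <= (2 * C)^-1 by rewrite invr_ge0; lra.
  split=> [x|x y]; first by rewrite normrM ger0_norm// -e ler_wpM2l.
  by rewrite -mulrBr normrM ger0_norm// -e -mulrA ler_wpM2l.
have half0 : 0 <= 1 / 2 :> R by lra.
have half1 : 1 / 2 + 1 / 2 <= 1 :> R by lra.
have := r_int half0 half0 half1 (half n) (half n.+1) (c := eta n).
rewrite !(bmeas_intZ (mcms_finite _) _ (approx_bmeas _ au)) ratioX_powR -mulrBr.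
rewrite normrM gtr0_norm ?invr_gt0// => H.
have : (2 * C)^-1 * `|E (X n) (u n) - E (X n.+1) (u n.+1)| <= (1 + 3 * M) * eta n.
  have := ratioX_le n; have e0 := eta_gt0 R n.
  have := ler_wpM2l (ltW e0) (mass_le n.+1).
  suff /H : forall x y, r x y <= ratio ^+ n ->
    `|(2 * C)^-1 * u n x - (2 * C)^-1 * u n.+1 y| <= eta n by lra.
  move=> x y /thread_edge [t [<- <-]].
  rewrite -mulrBr normrM gtr0_norm ?invr_gt0// ler_pdivrMl//.
  have [_ /(_ t) h1] := uP n; have [_ /(_ t) h2] := uP n.+1.
  have := ler_distD (h (p t)) (u n (sval t n)) (u n.+1 (sval t n.+1)).
  rewrite (distrC (h _) (u n.+1 _)) => h3; rewrite (etaS R n) in h1 *.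
  by have := mulr_ge0 (ltW C0) (ltW (eta_gt0 R n.+1)); lra.
by rewrite ler_pdivrMl// /rate mulrA.
Qed.

Let approx_cvg C u h : approximates C u h ->
  exists l, forall n, `|E (X n) (u n) - l| <= 2 * (rate C * eta n).
Proof.
move=> au; have [C0 _] := au; have K0 : 0 <= rate C.
  by apply: mulr_ge0; have := M_ge0; lra.
apply: geometric_limit => n; last exact: approx_step au.
  by rewrite mulr_ge0// ltW// eta_gt0.
by rewrite (etaS R n) mulrCA.
Qed.

Let approx_le C u h C' u' h' n : approximates C u h -> approximates C' u' h' ->
  (forall q, h q <= h' q) -> E (X n) (u n) <= E (X n) (u' n) + (C + C') * M * eta n.
Proof.
move=> au au' hh'; have [C0 uP] := au; have [C'0 u'P] := au'.
have bu := approx_bmeas n au; have bu' := approx_bmeas n au'.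
have bc := bmeas_cst (borel (X n)) ((C + C') * eta n).
apply: (@le_trans _ _ (E (X n) (fun x => u' n x + (C + C') * eta n))).
  apply: (bmeas_int_le (mcms_finite _) bu (bmeasD bu' bc)) => x.
  have [t <-] := thread_at x; have [_ /(_ t)] := uP n; have [_ /(_ t)] := u'P n.
  by have := hh' (p t); rewrite !ler_norml; lra.
rewrite (bmeas_intD (mcms_finite _) bu' bc) bmeas_int_cst lerD2l.
have := ler_wpM2l (ltW (eta_gt0 R n)) (mass_le n) => h1.
have CC : 0 <= C + C' by lra.
by have := ler_wpM2l CC h1; lra.
Qed.

(** Every approximation of [h] has the same limit of integrals ([limit_eq]); this makes the
    limit linear and positive in [h]. *)
Definition limit_value (h : Q -> R) (l : R) : Prop :=
  exists C u D, approximates C u h /\ forall n, `|E (X n) (u n) - l| <= D * eta n.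

Let limit_le h l h' l' : limit_value h l -> limit_value h' l' ->
  (forall q, h q <= h' q) -> l <= l'.
Proof.
move=> [C [u [D [au ul]]]] [C' [u' [D' [au' ul']]]] hh'.
apply: (@le_eta _ _ _ (D + D' + (C + C') * M)) => n.
have := approx_le n au au' hh'; have := ul n; have := ul' n.
by rewrite !ler_norml; lra.
Qed.

Let limit_eq h l l' : limit_value h l -> limit_value h l' -> l = l'.
Proof.
move=> hl hl'; apply/eqP; rewrite eq_le; apply/andP.
by split; [exact: limit_le hl hl' _|exact: limit_le hl' hl _].
Qed.

Let limitD h l h' l' : limit_value h l -> limit_value h' l' ->
  limit_value (fun q => h q + h' q) (l + l').
Proof.
move=> [C [u [D [au ul]]]] [C' [u' [D' [au' ul']]]].
exists (C + C'), (fun n x => u n x + u' n x), (D + D'); split.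
  have [C0 uP] := au; have [C'0 u'P] := au'; split; first by lra.
  move=> n; have [[us uL] ut] := uP n; have [[u's u'L] u't] := u'P n; split; first split.
  - by move=> x; rewrite (le_trans (ler_normD _ _))// lerD.
  - by move=> x y; rewrite opprD addrACA (le_trans (ler_normD _ _))// mulrDl lerD.
  - by move=> t; rewrite opprD addrACA (le_trans (ler_normD _ _))// mulrDl lerD.
move=> n; rewrite (bmeas_intD (mcms_finite _) (approx_bmeas n au) (approx_bmeas n au')).
by rewrite opprD addrACA (le_trans (ler_normD _ _))// mulrDl lerD.
Qed.

Let limitZ c h l : limit_value h l -> limit_value (fun q => c * h q) (c * l).
Proof.
move=> [C [u [D [au ul]]]].
exists ((`|c| + 1) * C), (fun n x => c * u n x), (`|c| * D); split; last first.
  move=> n; rewrite (bmeas_intZ (mcms_finite _) _ (approx_bmeas n au)) -mulrBr normrM -mulrA.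
  by rewrite ler_wpM2l.
have [C0 uP] := au; have c1 : 0 < `|c| + 1 by rewrite ltr_wpDl.
have key a b : `|a| <= C * b -> 0 <= b -> `|c * a| <= (`|c| + 1) * C * b.
  move=> ab b0; rewrite normrM -mulrA mulrDl mul1r.
  have := ler_wpM2l (normr_ge0 c) ab; have := mulr_ge0 (ltW C0) b0; lra.
split; first exact: mulr_gt0.
move=> n; have [[us uL] ut] := uP n; split; first split.
- by move=> x; rewrite -[X in _ <= X]mulr1; apply: key; rewrite ?mulr1.
- by move=> x y; rewrite -mulrBr; apply: key; rewrite ?powR_ge0.
- by move=> t; rewrite -mulrBr; apply: key; rewrite ?(ltW (eta_gt0 R n)).
Qed.

Let limit_exists h : holderian h -> exists l, limit_value h l.
Proof.
move=> [C hC]; have C0 : 0 <= C by case: hC => + _ => /(_ point); exact: le_trans.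
have C1 : 0 < C + 1 by lra.
have [u au] : exists u, approximates (2 * (C + 1)) u h.
  by apply: approx_exists => //; apply: holder_weaken hC; lra.
have [l hl] := approx_cvg au; exists l, (2 * (C + 1)), u, (2 * rate (2 * (C + 1))).
by split=> // n; rewrite -mulrA.
Qed.

(** The functional sending [h] to its limit value is represented by a Radon measure.
    The constant in the resulting estimate depends on [M] only, since unit-ball test
    functions have approximations with the same constant [C = 2]. *)
Lemma fast_limit : exists (Y : mcms R) (D : R), forall n,
  (mcms_dist k (X n) Y <= (D * eta n)%:E)%E.
Proof.
have /choice[I hI] (h : Q -> R) : exists l, holderian h -> limit_value h l.
  have [/limit_exists [l hl]|nh] := pselect (holderian h); first by exists l.
  by exists 0.
have I_add f g : holderian f -> holderian g -> I (fun x => f x + g x) = I f + I g.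
  move=> hf hg; apply: limit_eq (limitD (hI _ hf) (hI _ hg)).
  exact/hI/holderianD.
have I_scale c f : holderian f -> I (fun x => c * f x) = c * I f.
  move=> hf; apply: limit_eq (limitZ c (hI _ hf)).
  exact/hI/holderianZ.
have I_ge0 f : holderian f -> (forall x, 0 <= f x) -> 0 <= I f.
  move=> hf f0; have h0 := holderian_cst k Q 0.
  rewrite -(mul0r (I (fun=> 0))).
  by apply: (limit_le (limitZ 0 (hI _ h0)) (hI _ hf)) => q; rewrite mul0r.
have [m [m_radon mI]] := riesz_holderian k01 Q_compact I_add I_scale I_ge0.
pose Y := MCMS Q_compact m_radon; exists Y, (8 + 28 * M) => n.
have e0 := eta_gt0 R n; have M0 := M_ge0.
have Me := mulr_ge0 M0 (ltW e0).
have d0 : 0 <= 2 * ratio ^+ n by have := ratioX_gt0 n; lra.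
have <- : Num.max (2 * ratio ^+ n) ((8 + 28 * M) * eta n) = (8 + 28 * M) * eta n.
  by rewrite max_r//; have := ratioX_le n; lra.
apply: (mcms_dist_le_correspondence k01 (Y := Y) d0 (passes_corr n)).
move=> s L h1 h2 s0 L0 sL hh1 hh2 h12.
have h2C : holder 1 1 h2 by apply: holder_weaken hh2; lra.
have [u au] := approx_exists ltr01 h2C.
have [l hl] := approx_cvg au.
have h2H : holderian h2 by exists 1.
have El : E Y h2 = l.
  rewrite [LHS](mI _ h2H); apply: limit_eq (hI _ h2H) _.
  by exists (2 * 1), u, (2 * rate (2 * 1)); split=> // j; rewrite -mulrA.
have h1u : `|E (X n) h1 - E (X n) (u n)| <= 4 * eta n * mass (X n).
  apply: (bmeas_int_dist (mcms_finite _) (holder_bmeas k01 hh1) (approx_bmeas n au)) => x.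
  have [t tx] := thread_at x; have := h12 x (p t) (ex_intro _ t (conj tx erefl)).
  have [_ /(_ n) [_ /(_ t)]] := au; rewrite tx => a1 a2.
  have := ler_distD (h2 (p t)) (h1 x) (u n x); rewrite (distrC (h2 _) (u n x)).
  by have := delta_powR n; lra.
have := hl n; have := ler_distD (E (X n) (u n)) (E (X n) h1) (E Y h2).
have := ler_wpM2l (ltW e0) (mass_le n); rewrite El /rate; lra.
Qed.

End complete_fast.

Section completeness.
Context (R : realType) (k : R).
Hypothesis k01 : 0 < k <= 1.

Lemma complete_fast (X : nat -> mcms R) :
  (forall n, (mcms_dist k (X n) (X n.+1) < (ratio k ^+ n)%:E)%E) ->
  exists (Y : mcms R) (D : R), forall n, (mcms_dist k (X n) Y <= (D * eta R n)%:E)%E.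
Proof.
move=> X_fast.
pose cp n := cid (mcms_dist_lt_coupling k01 (X_fast n)).
have c1 n : coupling (projT1 (cp n)) by have [] := projT2 (cp n).
have c2 n x : exists y, projT1 (cp n) x y <= ratio k ^+ n.
  by have [_ + _ _] := projT2 (cp n) => /(_ x).
have c3 n y : exists x, projT1 (cp n) x y <= ratio k ^+ n.
  by have [_ _ + _] := projT2 (cp n) => /(_ y).
have [Q [p [ps pd]]] := thread_space k01 c1 c2 c3.
apply: (fast_limit X_fast c2 c3 _ ps pd) => n.
by have [] := projT2 (cp n).
Qed.

Lemma cvge0 (d : nat -> \bar R) : (forall n, (0 <= d n)%E) ->
  (forall e : R, 0 < e -> exists N : nat, forall n, (N <= n)%N -> (d n < e%:E)%E) ->
  d @ \oo --> 0%E.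
Proof.
move=> d0 H; apply/fine_cvgP; split.
  have [N hN] := H 1 ltr01; exists N => // n /= /hN h.
  by rewrite ge0_fin_numE//; apply: lt_trans h (ltry _).
apply/cvgrPdist_lt => e e0; have [N hN] := H e e0; exists N => // n /= /hN h.
rewrite sub0r normrN ger0_norm ?fine_ge0// -lte_fin fineK//.
by rewrite ge0_fin_numE//; apply: lt_trans h (ltry _).
Qed.

(** [phi n] dominates [N n] and increases with [n], so consecutive terms of the subsequence
    are within [ratio ^+ n]. *)
Lemma mcms_complete (K : set (mcms R)) : representatives K ->
  complete_on K (mcms_dist k).
Proof.
move=> hK u Ku cauchy.
have /choice[N hN] (n : nat) := cauchy _ (ratioX_gt0 k n).
pose phi n := (\sum_(i < n.+1) N i)%N.
have phi_ge n : (N n <= phi n)%N by rewrite /phi big_ord_recr/= leq_addl.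
have phi_nd n : (phi n <= phi n.+1)%N by rewrite /phi [leqRHS]big_ord_recr/= leq_addr.
have fast n : (mcms_dist k (u (phi n)) (u (phi n.+1)) < (ratio k ^+ n)%:E)%E.
  by apply: hN => //; exact: leq_trans (phi_nd n).
have [Y [D hD]] := complete_fast fast.
have [l [[Kl Yl] _]] := hK Y; exists l => //.
apply: cvge0 => [n|e e0]; first exact: mcms_dist_ge0.
have D2 : 0 < `|D| + 1 + 1 by have := normr_ge0 D; lra.
have [j hj] := eta_small (divr_gt0 e0 D2).
exists (N j) => n nj; apply: le_lt_trans (mcms_dist_triangle k01 _ (u (phi j)) _) _.
have dl : (mcms_dist k (u (phi j)) l <= (D * eta R j)%:E)%E.
  apply: le_trans (mcms_dist_triangle k01 _ Y _) _.
  by rewrite (mcms_equiv_dist0 k01 Yl) adde0.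
apply: (@lt_le_trans _ _ ((ratio k ^+ j)%:E + (D * eta R j)%:E)%E).
  apply: lte_leD => //; last exact: hN.
  by rewrite ge0_fin_numE ?mcms_dist_ge0// mcms_dist_lty.
rewrite -EFinD lee_fin; move: hj; rewrite ltr_pdivlMr// => hj.
have := eta_gt0 R j; have := ratioX_le k01 j.
have := ler_wpM2r (ltW (eta_gt0 R j)) (ler_norm D); lra.
Qed.

End completeness.

(** * Separability *)
Section separability.
Context (R : realType) (k : R).
Hypothesis k01 : 0 < k <= 1.
Local Notation holder := (holder k).
Local Notation E X h := (\int[mcms_mu X]_x h x).
Local Notation mass X := (fine (mcms_mu X setT)).

Section cells.
Variables (X : pmetricType R) (n : nat) (a : 'I_n.+1 -> X) (e : R).

(** Assigning each point to the first ball of the net that contains it turns the cover into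
    a Borel partition. *)
Definition cell (i : 'I_n.+1) : set X :=
  [set x | mdist (a i) x < e /\ forall j : 'I_n.+1, (j < i)%N -> ~ mdist (a j) x < e].

Lemma cell_measurable i : measurable (cell i : set (borel X)).
Proof.
have ob j : open [set x | mdist (a j) x < e].
  rewrite openE => x /= xe; apply/nbhs_ballP; exists (e - mdist (a j) x).
    by rewrite /= subr_gt0.
  rewrite ballEmdist => y /= xy; have := metric_triangle (a j) x y; lra.
rewrite (_ : cell i = [set x | mdist (a i) x < e] `&`
    \bigcap_(j in [set j : 'I_n.+1 | (j < i)%N]) ~` [set x | mdist (a j) x < e]).
  apply: measurableI; first exact: open_borel.
  apply: fin_bigcap_measurable => // j _; apply: measurableC; exact: open_borel.
by apply/seteqP; split=> x [h1 h2]; split=> // j ji; exact: h2.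
Qed.

Lemma cellP x : (exists i, mdist (a i) x < e) ->
  exists2 i, mdist (a i) x < e & forall j, \1_(cell j) x = (j == i)%:R :> R.
Proof.
move=> [i0 xi0].
have ex : exists m, (m < n.+1)%N && (mdist (a (inord m)) x < e).
  by exists i0; rewrite ltn_ord inord_val.
case: (ex_minnP ex) => m /andP[mn xm] min; exists (inord m) => // j.
rewrite indicE; congr (nat_of_bool _)%:R; apply/idP/eqP => [/set_mem[xj hj]|->].
  apply/val_inj; rewrite /= inordK//.
  apply/eqP; rewrite eqn_leq; apply/andP; split; last first.
    by apply: min; rewrite ltn_ord inord_val.
  rewrite leqNgt; apply/negP => mj; apply: (hj (inord m)) => //.
  by rewrite inordK.
apply: mem_set; split=> // i; rewrite inordK// => im xi.
have := min i; rewrite ltn_ord inord_val xi => /(_ isT).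
by rewrite leqNgt im.
Qed.

End cells.

Lemma discretization (X : mcms R) (e : R) : 0 < e ->
  exists (n : nat) (a : 'I_n.+1 -> X) (w : 'I_n.+1 -> R),
  [/\ forall x, exists i, mdist (a i) x < e, forall i, 0 <= w i
    & forall (s L : R) (h : X -> R), 0 <= L -> L <= 1 -> holder s L h ->
      `|E X h - \sum_i w i * h (a i)| <= e `^ k * mass X].
Proof.
move=> e0; have [n [a an]] := finite_net (@mcms_compact _ X) e0.
exists n, a, (fun i => fine (mcms_mu X (cell a e i))); split => //.
move=> s L h L0 L1 hh; have bh := holder_bmeas k01 hh.
have bi i : bounded_measurable (\1_(cell a e i) : borel X -> R).
  by apply: bmeas_indic; exact: cell_measurable.
have -> : \sum_i fine (mcms_mu X (cell a e i)) * h (a i) =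
    \int[mcms_mu X]_x (\sum_i h (a i) * \1_(cell a e i) x).
  rewrite (bmeas_int_sum (mcms_finite X)) => [|i]; last exact: bmeasZ.
  apply: eq_bigr => i _; rewrite (bmeas_intZ (mcms_finite X))// mulrC.
  by rewrite bmeas_int_indic//; exact: cell_measurable.
apply: (bmeas_int_dist (mcms_finite X)) => //.
  by apply: bmeas_sum => i; exact: bmeasZ.
move=> x; have [i xi ci] := cellP (an x).
rewrite (bigD1 i)//= big1 => [|j ji]; last by rewrite ci (negbTE ji) mulr0.
rewrite ci eqxx mulr1 addr0; have [_ hL] := hh.
apply: le_trans (hL _ _) _; rewrite -[X in _ <= X]mul1r.
apply: ler_pM => //; first exact: powR_ge0.
by rewrite metric_sym; apply: powR_le => //; [exact: mdist_ge0|exact: ltW].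
Qed.

(** The size of a net (minus one), its distance matrix, and its weights. *)
Definition code := {n : nat &
  ({ffun 'I_n.+1 * 'I_n.+1 -> rat} * {ffun 'I_n.+1 -> rat})%type}.

Definition represents (e : R) (c : code) (X : mcms R) : Prop :=
  exists (a : 'I_(projT1 c).+1 -> X) (w : 'I_(projT1 c).+1 -> R),
  [/\ (forall x, exists i, mdist (a i) x < e) /\ (forall i, 0 <= w i),
      forall (s L : R) (h : X -> R), 0 <= L -> L <= 1 -> holder s L h ->
        `|E X h - \sum_i w i * h (a i)| <= e,
      forall i j, `|mdist (a i) (a j) - ratr ((projT2 c).1 (i, j))| <= e
    & \sum_i `|w i - ratr ((projT2 c).2 i)| <= e].

Lemma rat_approx (x e : R) : 0 < e -> exists q : rat, `|x - ratr q| <= e.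
Proof.
move=> e0; have [|q] := @rat_in_itvoo _ (x - e) (x + e); first by lra.
by rewrite in_itv/= => /andP[h1 h2]; exists q; rewrite ler_norml; lra.
Qed.

Lemma represents_exists (X : mcms R) (e : R) : 0 < e -> exists c, represents e c X.
Proof.
move=> e0; have m0 := mass_ge0 X; have m1 : 0 < mass X + 1 by lra.
have [d d0 dk] := powR_small k01 (divr_gt0 e0 m1).
pose d' := Num.min d e; have d'0 : 0 < d' by rewrite lt_min d0.
have [n [a [w [an w0 hw]]]] := discretization X d'0.
have en : 0 < e / n.+1%:R by rewrite divr_gt0.
have /choice[q hq] (ij : 'I_n.+1 * 'I_n.+1) := rat_approx (mdist (a ij.1) (a ij.2)) e0.
have /choice[v hv] (i : 'I_n.+1) := rat_approx (w i) en.
exists (existT _ n ([ffun ij => q ij], [ffun i => v i])), a, w; split => /=.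
- split=> // x; have [i ix] := an x; exists i; apply: lt_le_trans ix _.
  by rewrite ge_min lexx orbT.
- move=> s L h L0 L1 hh; apply: le_trans (hw s L h L0 L1 hh) _.
  have : d' `^ k <= e / (mass X + 1).
    by apply: le_trans dk; apply: powR_le => //; [exact: ltW|rewrite ge_min lexx].
  move=> /(ler_wpM2r m0) /le_trans; apply.
  by rewrite mulrAC -mulrA ger_pMr// ler_pdivrMr// mul1r; lra.
- by move=> i j; rewrite ffunE; exact: hq (i, j).
- apply: (@le_trans _ _ (\sum_(i < n.+1) e / n.+1%:R)).
    by apply: ler_sum => i _; rewrite ffunE.
  by rewrite sumr_const card_ord -(mulr_natr (e / _)) divfK// pnatr_eq0.
Qed.

(** Points are related when both are near net points of the same index; the code makes the
    two distance matrices and the two weight vectors almost equal. *)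
Lemma represents_dist (X Y : mcms R) (e : R) c : 0 < e ->
  represents e c X -> represents e c Y ->
  (mcms_dist k X Y <= (Num.max (3 * e) (4 * e + (mass X + e) * (3 * e) `^ k))%:E)%E.
Proof.
move=> e0 [a [w [[an w0] hw ha wp]]] [b [v [[bn v0] hv hb vp]]].
have e3 : 0 <= 3 * e by lra.
pose S x y := exists i, mdist (a i) x < e /\ mdist (b i) y < e.
apply: (mcms_dist_le_correspondence k01 (S := S) e3).
  split=> [x|y|x y x' y' [i [xi yi]] [j [xj yj]]|x y x' y' [i [xi yi]] [j [xj yj]]].
  - by have [i xi] := an x; exists (b i), i; rewrite mdistxx.
  - by have [i yi] := bn y; exists (a i), i; rewrite mdistxx.
  - have := ha i j; have := hb i j; rewrite !ler_norml.
    have := metric_triangle x (a i) x'; have := metric_triangle (a i) (a j) x'.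
    have := metric_triangle (b i) y (b j); have := metric_triangle y y' (b j).
    by rewrite (metric_sym x (a i)) (metric_sym y' (b j)); lra.
  - have := ha i j; have := hb i j; rewrite !ler_norml.
    have := metric_triangle y (b i) y'; have := metric_triangle (b i) (b j) y'.
    have := metric_triangle (a i) x (a j); have := metric_triangle x x' (a j).
    by rewrite (metric_sym y (b i)) (metric_sym x' (a j)); lra.
move=> s L h1 h2 s0 L0 sL hh1 hh2 h12.
have L1 : L <= 1 by lra.
have k1 := hw s L h1 L0 L1 hh1; have k2 := hv s L h2 L0 L1 hh2.
have wm : \sum_i w i <= mass X + e.
  have h1c : holder 1 0 (fun _ : X => 1 : R).
    by split=> *; rewrite ?normr1// subrr normr0 mul0r.
  have := hw 1 0 _ (lexx 0) ler01 h1c; rewrite bmeas_int_cst mul1r.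
  by under eq_bigr do rewrite mulr1; rewrite ler_norml; lra.
have k3 : `|\sum_i w i * h1 (a i) - \sum_i v i * h2 (b i)| <=
    (mass X + e) * (3 * e) `^ k + 2 * e.
  rewrite -sumrB; apply: le_trans (ler_norm_sum _ _ _) _.
  apply: (@le_trans _ _ (\sum_i (w i * (3 * e) `^ k +
     (`|w i - ratr ((projT2 c).2 i)| + `|v i - ratr ((projT2 c).2 i)|)))).
    apply: ler_sum => i _.
    have ab : `|h1 (a i) - h2 (b i)| <= (3 * e) `^ k.
      by apply: h12; exists i; rewrite !mdistxx.
    have hb1 : `|h2 (b i)| <= 1 by have [+ _] := hh2 => /(_ (b i)); lra.
    have -> : w i * h1 (a i) - v i * h2 (b i) =
      w i * (h1 (a i) - h2 (b i)) + (w i - v i) * h2 (b i) by lra.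
    apply: le_trans (ler_normD _ _) _; apply: lerD.
      by rewrite normrM ger0_norm// ler_wpM2l.
    rewrite normrM; apply: (@le_trans _ _ (`|w i - v i| * 1)); first by rewrite ler_wpM2l.
    rewrite mulr1 (distrC (v i)); exact: ler_distD.
  rewrite big_split/= big_split/= -mulr_suml.
  by have := ler_wpM2r (powR_ge0 (3 * e) k) wm; lra.
have := ler_distD (\sum_i w i * h1 (a i)) (E X h1) (E Y h2).
have := ler_distD (\sum_i v i * h2 (b i)) (\sum_i w i * h1 (a i)) (E Y h2).
by rewrite (distrC (\sum_i v i * h2 (b i)) (E Y h2)); lra.
Qed.

(** For each precision and code that some element of [K] realizes, one such element is
    chosen; no space has to be built from a rational code. *)
Lemma mcms_separable (K : set (mcms R)) : separable_on K (mcms_dist k).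
Proof.
have /choice[G hG] (mc : nat * code) : exists o : option (mcms R),
    (exists2 Y, K Y & represents (eta R mc.1) mc.2 Y) ->
    exists Y, [/\ o = Some Y, K Y & represents (eta R mc.1) mc.2 Y].
  have [[Y KY rY]|nY] := pselect (exists2 Y, K Y & represents (eta R mc.1) mc.2 Y).
    by exists (Some Y) => _; exists Y.
  by exists None.
exists [set Y | K Y /\ exists mc, G mc = Some Y]; split.
- by move=> Y [].
- have /choice[F hF] (Y : mcms R) : exists mc, (exists mc, G mc = Some Y) -> G mc = Some Y.
    have [[mc e]|h] := pselect (exists mc, G mc = Some Y); first by exists mc.
    by exists (0%N, existT _ 0%N ([ffun=> 0], [ffun=> 0])).
  apply/countable_injP; exists (fun Y => choice.pickle (F Y)) => Y Y'.
  move=> /set_mem[_ /hF GY] /set_mem[_ /hF GY'] /(pcan_inj choice.pickleK) FF.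
  by apply: Some_inj; rewrite -GY -GY' FF.
move=> X KX e e0; have m0 := mass_ge0 X.
pose c := e / (mass X + 6); have m6 : 0 < mass X + 6 by lra.
have c0 : 0 < c by rewrite divr_gt0.
have ec : e = c * (mass X + 6) by rewrite divfK// gt_eqF.
have [b b0 bc] := powR_small k01 c0.
(* [d] bounds the precision [eta m] such that both terms of [represents_dist] are below [e];
   the second one is at most [4 * c + (mass X + 1) * c]. *)
pose d := Num.min (b / 3) (Num.min c 1).
have d0 : 0 < d by rewrite !lt_min c0 ltr01 divr_gt0.
have [m hm] := eta_small d0; have em := eta_gt0 R m.
have [mc hmc] := represents_exists X em.
have [|Y [GY KY rY]] := hG (m, mc); first by exists X.
exists Y; first by split=> //; exists (m, mc).
apply: le_lt_trans (represents_dist em hmc rY) _; rewrite lte_fin gt_max.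
move: hm; rewrite !lt_min => /and3P[hb hc h1].
have pk : (3 * eta R m) `^ k <= c.
  by apply: le_trans bc; apply: powR_le => //; lra.
have p0 := powR_ge0 (3 * eta R m) k.
have q1 := mulr_ge0 (ltW c0) m0.
apply/andP; split; first by lra.
have : (mass X + eta R m) * (3 * eta R m) `^ k <= (mass X + 1) * c.
  by apply: ler_pM => //; lra.
lra.
Qed.

End separability.

Theorem theorem2p27 (R : realType) (kappa : R) (hkappa : 0 < kappa <= 1)
    (K : set (mcms R)) (hK : representatives K) :
  [/\ metric_on K (mcms_dist kappa),
      complete_on K (mcms_dist kappa)
    & separable_on K (mcms_dist kappa)].
Proof.
split; [|exact: mcms_complete|exact: mcms_separable].
split=> [X Y _ _|X Y KX KY|X Y _ _|X Y W _ _ _].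
- by rewrite mcms_dist_ge0 mcms_dist_lty.
- split=> [/(mcms_dist0_equiv hkappa) XY|<-]; last first.
    exact/(mcms_equiv_dist0 hkappa)/mcms_equiv_refl.
  have [Z [_ uZ]] := hK X.
  by rewrite -(uZ X) ?(uZ Y)//; split=> //; exact: mcms_equiv_refl.
- exact: mcms_dist_sym.
- exact: mcms_dist_triangle.
Qed.
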